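(* Let $R=\mathbb{Z}$ or $\mathbb{F}_p$ ($p$ a prime), let $X$ be a set, and let $\tau\colon X\to \mathsf{T}^2_R(X)$ be a map of sets. If $\tau$ is admissible, then $d_\tau^2\equiv 0$, and the map $\mathsf{T}^1_R(X)\to C^1(\Delta(M_\tau);R)$ given by $q\mapsto(\mathbf{a}\mapsto q(\mathbf{a}))$ extends uniquely to a monomorphism $$\psi_X\colon (\mathsf{T}_R(X),d_\tau)\hookrightarrow (C^*(\Delta(M_\tau);R),d_\Delta)$$ of binomial cup-one dgas.
   Context: Free binomial algebra. For a set $X$, $\mathrm{Int}(\mathbb{Z}^X)=\{q\in\mathbb{Q}[X] : q(\mathbb{Z}^X)\subseteq\mathbb{Z}\}$, and $\mathrm{Int}(\mathbb{F}_p^X)$ is the quotient of $\mathrm{Int}(\mathbb{Z}^X)$ by the ideal generated by $\zeta_n(x)=\binom{x}{n}$ ($x\in X$, $n\ge p$), tensored with $\mathbb{F}_p$. Let $\mathfrak{m}_{X,R}\subset \mathrm{Int}(R^X)$ be the submodule of polynomials with zero constant term, and $\mathsf{T}_R(X)=T^*(\mathfrak{m}_{X,R})$ the tensor algebra over $R$, with product $\cup=\otimes$ and maps $a\cup_1 b=ab$ on $\mathsf{T}^1=\mathfrak{m}_{X,R}$, $(a\otimes b)\cup_1 c=ac\otimes b+a\otimes bc$, and $(a_1\otimes a_2)\circ(b_1\otimes b_2)=a_1b_1\otimes a_2b_2$. The map $d_\tau$. For every set map $\tau\colon X\to\mathsf{T}_R^2(X)$, $d_\tau\colon\mathsf{T}_R(X)\to\mathsf{T}_R(X)$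 denotes the unique degree-1 $R$-linear map with $d_\tau(x)=\tau(x)$ for $x\in X$ satisfying the graded Leibniz rule and the $\cup_1$–$d$ formula $d(a\cup_1 b)=-a\cup b-b\cup a+da\cup_1 b+db\cup_1 a-da\circ db$ for $a,b\in\mathsf{T}^1_R(X)$. The magma $M_\tau$. Let $M=M(X,R)$ be the set of all functions $\mathbf{a}\colon X\to R$; an element $q\in\mathrm{Int}(R^X)$ is evaluated at $\mathbf a$ to give $q(\mathbf a)\in R$. Write $\tau(x)=\sum_i p_{x,i}\otimes q_{x,i}$ with $p_{x,i},q_{x,i}\in\mathfrak{m}_{X,R}$, and define $\mu_\tau\colon M\times M\to M$ by $\mu_\tau(\mathbf a,\mathbf a')(x)=\mathbf a(x)+\mathbf a'(x)-\sum_i p_{x,i}(\mathbf a)q_{x,i}(\mathbf a')$. Then $M_\tau=(M,\mu_\tau)$ is a magma with two-sided unit the zero function. $\tau$ is called admissible if $\mu_\tau$ is associative. $\Delta(M_\tau)$ and its cochains. For a semigroup $M$, $\Delta(M)$ is the $\Delta$-set with one vertex whose $n$-simplices are the $n$-tuples $(a_1,\dots,a_n)\in M^n$, the edge from vertex $i$ to vertex $j$ ($i<j$) being $a_{i+1}\cdots a_j$ (so faces are as in the bar construction). $C^*(\Delta(M);R)$ is its simplicial cochain dga with the usual coboundary $d_\Delta$ (e.g. $(d_\Delta f)(a,a')=f(a)+f(a')-f(aa')$ for 1-cochains) and cup product (front face times back face). For a $\Delta$-set it is a binomial cup-one dga with $(f\cup_1 g)(e)=f(e)g(e)$ on 1-cochains,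 $(v\circ w)(s)=v(s)w(s)$ on 2-cochains, $\cup_1$ of decomposable 2-cochains with 1-cochains given by $(a\cup b)\cup_1 c=a\cup(b\cup_1 c)+(a\cup_1 c)\cup b$, and $\zeta_n(f)(e)=\binom{f(e)}{n}$ on 1-cochains. Binomial cup-one dga. A dga over $R$ is a graded $R$-algebra $A=\bigoplus_{i\ge0}A^i$ (product $\cup$) with a degree-one map $d$, $d^2=0$, satisfying the graded Leibniz rule. $D^2(A)\subset A^2$ is the span of all $a\cup b$, $a,b\in A^1$. A cup-one dga is a dga with $R$-linear maps $\cup_1\colon A^1\otimes_R A^1\to A^1$, $\cup_1\colon D^2(A)\otimes_R A^1\to A^2$, $\circ\colon D^2(A)\otimes_R D^2(A)\to D^2(A)$ such that: (i) $R\oplus A^1$ with $\cup_1$ as multiplication on $A^1$ is a commutative $R$-algebra with identity $1\in R$; (ii) $(a\cup b)\cup_1 c=a\cup(b\cup_1 c)+(a\cup_1 c)\cup b$ for $a,b,c\in A^1$; (iii) $(u\cup v)\circ(w\cup z)=(u\cup_1 w)\cup(v\cup_1 z)$; (iv) $a\cup_1 dc=a\cup c-c\cup a$ for $a\in A^1$, $c\in A^0$; (v) the $\cup_1$–$d$ formula holds for $a,b\in A^1$ with $da,db\in D^2(A)$. It is binomial if $A^0$ (under $\cup$) and $R\oplus A^1$ (under $\cup_1$) are $R$-binomial algebras: for $R=\mathbb Z$, torsion-free commutative rings containing $\zeta_n(a)=\binom{a}{n}$ for all $a$, $n>0$; for $R=\mathbb F_p$, commutative $\mathbb F_p$-algebras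 with $a^p=a$ for all $a$ (then $\zeta_n(a)=a(a-1)\cdots(a-n+1)/n!$ is defined for $1\le n\le p-1$). Morphisms are degree-preserving dga maps commuting with $\cup_1$ on $A^1$ and with the $\zeta_n$ on $A^1$. *)

(* Defs.v *)
From HB Require Import structures.
From mathcomp Require Import all_boot all_order all_algebra.
From mathcomp Require Import finmap.
From mathcomp Require Import boolp classical_sets functions.
From mathcomp.multinomials Require Import monalg.

Set Implicit Arguments.
Unset Strict Implicit.
Unset Printing Implicit Defensive.

Import GRing.Theory Num.Theory.
Local Open Scope ring_scope.
Local Open Scope quotient_scope.

Definition lspan (R : pzRingType) (V : lmodType R) (G : V -> Prop) : {pred V} :=
  fun v => `[< exists s : seq (R * V),
    (forall rg, rg \in s -> G rg.2) /\ v = \sum_(rg <- s) rg.1 *: rg.2 >].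

Lemma lspan_closed (R : pzRingType) (V : lmodType R) (G : V -> Prop) :
  subsemimod_closed (lspan G).
Proof.
split; first split.
- by apply/asboolP; exists [::]; rewrite big_nil.
- move=> u v /asboolP[s [Gs ->]] /asboolP[t [Gt ->]]; apply/asboolP.
  exists (s ++ t); rewrite big_cat; split=> // rg.
  by rewrite mem_cat => /orP[/Gs|/Gt].
move=> r u /asboolP[s [Gs ->]]; apply/asboolP.
exists [seq (r * rg.1, rg.2) | rg <- s]; split.
  by move=> _ /mapP[rg /Gs Grg ->].
by rewrite big_map scaler_sumr; apply: eq_bigr => rg _; rewrite scalerA.
Qed.

Section IntZ.
Variable X : choiceType.

Definition Qpoly := {malg rat[{cmonom X}]}.

HB.instance Definition _ := GRing.ComAlgebra.on Qpoly.

Definition meval (a : X -> rat) (m : {cmonom X}) : rat :=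
  \prod_(x <- finsupp m) a x ^+ m x.

Lemma meval_mmorphism a : mmorphism (meval a).
Proof.
have E (m : {cmonom X}) (D : {fset X}) : (finsupp m `<=` D)%fset ->
    meval a m = \prod_(x <- D) a x ^+ m x.
  move=> sub; rewrite /meval (big_fset_incl _ sub) // => x _.
  by rewrite -cmE_neq0 negbK => /eqP->; rewrite expr0.
split=> [m n|]; last by rewrite /meval mdom1 big_seq_fset0.
pose D := (finsupp m `|` finsupp n)%fset.
rewrite (E _ D) ?mdomD // (E m D) ?fsubsetUl // (E n D) ?fsubsetUr //.
by rewrite -big_split; apply: eq_bigr => x _; rewrite cmM exprD.
Qed.

HB.instance Definition _ a :=
  isMultiplicative.Build {cmonom X} rat (meval a) (meval_mmorphism a).

Definition qeval (a : X -> rat) (q : Qpoly) : rat := mmap idfun (meval a) q.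

HB.instance Definition _ a := GRing.RMorphism.copy (qeval a)
  (mmap (idfun : {rmorphism rat -> rat}) (meval a)).

Definition qvar (x : X) : Qpoly := << ucm x >>.

Definition qbinom (q : Qpoly) (n : nat) : Qpoly :=
  (n`!%:R : rat)^-1 *: \prod_(i < n) (q - i%:R).

Definition intvalued : {pred Qpoly} := fun q =>
  `[< forall a : X -> int, exists z : int, qeval (fun x => (a x)%:~R) q = z%:~R >].

Lemma intvalued_closed : subring_closed intvalued.
Proof.
split=> [|p q /asboolP zp /asboolP zq|p q /asboolP zp /asboolP zq];
    apply/asboolP => a; last 2 first.
- have [[y py] [z qz]] := (zp a, zq a).
  by exists (y - z); rewrite rmorphB /= py qz rmorphB.
- have [[y py] [z qz]] := (zp a, zq a).
  by exists (y * z); rewrite rmorphM /= py qz rmorphM.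
by exists 1; rewrite rmorph1.
Qed.

HB.instance Definition _ :=
  GRing.isSubringClosed.Build Qpoly intvalued intvalued_closed.

Record IntZ := MkIntZ { IntZ_val :> Qpoly; _ : IntZ_val \in intvalued }.

HB.instance Definition _ := [isSub for IntZ_val].
HB.instance Definition _ := [Choice of IntZ by <:].
HB.instance Definition _ := [SubChoice_isSubComNzRing of IntZ by <:].

Definition IntZ_scale (n : int) (q : IntZ) := q *~ n.

Lemma IntZ_scaleA m n q :
  IntZ_scale m (IntZ_scale n q) = IntZ_scale (m * n) q.
Proof. exact: mulrzA_C. Qed.
Lemma IntZ_scale1 : left_id 1 IntZ_scale. Proof. by []. Qed.
Lemma IntZ_scaleDr : right_distributive IntZ_scale +%R.
Proof. by move=> n q r; apply: mulrzDl. Qed.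
Lemma IntZ_scaleDl q : {morph IntZ_scale^~ q : m n / m + n}.
Proof. by move=> m n; apply: mulrzDr. Qed.

HB.instance Definition _ := GRing.Zmodule_isLmodule.Build int IntZ
  IntZ_scaleA IntZ_scale1 IntZ_scaleDr IntZ_scaleDl.

Lemma IntZ_scaleAl (n : int) (q r : IntZ) : n *: (q * r) = n *: q * r.
Proof. by rewrite /GRing.scale /= /IntZ_scale mulrzAl. Qed.

HB.instance Definition _ := GRing.Lmodule_isLalgebra.Build int IntZ IntZ_scaleAl.
HB.instance Definition _ := GRing.Lalgebra_isComAlgebra.Build int IntZ.

Definition IntZ_eval (q : IntZ) (a : X -> int) : int :=
  numq (qeval (fun x => (a x)%:~R) q).

Lemma IntZ_evalE q a : (IntZ_eval q a)%:~R = qeval (fun x => (a x)%:~R) q.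
Proof.
by case: q => q /= qZ; case: (asboolP _ qZ a) => z qz; rewrite /IntZ_eval /= qz numq_int.
Qed.

Lemma qeval_var a x : qeval a (qvar x) = a x.
Proof.
by rewrite /qeval mmapU mul1r /meval mdomU big_seq_fset1 cmUU.
Qed.

Lemma qvar_intvalued x : qvar x \in intvalued.
Proof. by apply/asboolP => a; exists (a x); rewrite qeval_var. Qed.

Definition IntZ_var (x : X) : IntZ := MkIntZ (qvar_intvalued x).

Definition IntZ_zero_const : {pred IntZ} := fun q => mcoeff mone (val q) == 0.

End IntZ.

Section IntF.
Variables (X : choiceType) (p : nat) (p_pr : prime p).

Definition IntF_gen (g : IntZ X) : Prop :=
  (exists x n, (p <= n)%N /\ val g = qbinom (qvar x) n) \/ g = p%:R.

(* The ideal (zeta_n(x), p) for x in X and n >= p: tensoring with F_p is the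
   quotient by p. *)
Definition IntF_ideal of prime p : {pred IntZ X} :=
  lspan (V := (IntZ X)^o) IntF_gen.

Lemma IntF_ideal_closed : idealr_closed (IntF_ideal p_pr).
Proof.
have [[S0 SD] SZ] := lspan_closed (V := (IntZ X)^o) IntF_gen.
split=> //; last by move=> a u v Su Sv; apply: SD => //; apply: SZ.
pose e (q : IntZ X) := qeval (fun=> 0) (IntZ_val q).
have eD u v : e (u + v) = e u + e v by rewrite -rmorphD.
have eM u v : e (u * v) = e u * e v by rewrite -rmorphM.
apply/asboolP => -[s [Gs /(congr1 e)]].
suff [z ->] : exists z : int,
    e (\sum_(rg <- s) rg.1 *: rg.2 : (IntZ X)^o) = p%:R * z%:~R.
  rewrite /e rmorph1 -[p%:R]/((p%:Z)%:~R) -rmorphM -[1]/(1%:~R).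
  move=> /eqP; rewrite eqr_int => /eqP pz.
  have := dvdz_mulr z (dvdzz p); rewrite -pz dvdz1 absz_nat => /eqP p1.
  by have := prime_gt1 p_pr; rewrite p1.
elim: s Gs => [|[r g] s IHs] Gs.
  by exists 0; rewrite big_nil /e !rmorph0 mulr0.
have [|z Ez] := IHs; first by move=> rg srg; apply: Gs; rewrite inE srg orbT.
rewrite big_cons eD Ez.
have [y ->] : exists y : int, e (r * g) = p%:R * y%:~R.
  rewrite eM; have [/= [x [n [le_pn Eg]]]|/= ->] := Gs _ (mem_head _ _); last first.
    exists (IntZ_eval r (fun=> 0)); rewrite IntZ_evalE mulrC.
    by rewrite -[e p%:R]/((qeval (fun=> 0) \o val) p%:R) rmorph_nat.
  exists 0; rewrite mulr0 /e {}Eg /qbinom -mul_malgC rmorphM rmorph_prod /=.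
  case: n le_pn => [|n _]; first by rewrite leqNgt prime_gt0.
  have qx0 : qeval (fun=> 0) (qvar x - (ord0 : 'I_n.+1)%:R) = 0.
    by rewrite subr0 qeval_var.
  by rewrite big_ord_recl qx0 mul0r !mulr0.
by exists (y + z); rewrite rmorphD mulrDr.
Qed.

HB.instance Definition _ :=
  isIdealr.Build (IntZ X) (IntF_ideal p_pr) IntF_ideal_closed.

Definition IntF := {ideal_quot (IntF_ideal p_pr : idealr (IntZ X))}.

HB.instance Definition _ := GRing.ComNzRing.on IntF.

End IntF.
Section IntFAlg.
Variables (X : choiceType) (p : nat) (p_pr : prime p).
Local Notation F := (IntF X p_pr).

Lemma IntF_pchar : (p%:R : F) = 0.
Proof.
rewrite -(rmorph_nat (\pi_F : {rmorphism IntZ X -> F})) /=.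
rewrite -(pi_zeror (s := F)); apply/eqP; rewrite -Quotient.idealrBE subr0.
apply/asboolP; exists [:: (1, p%:R)].
rewrite big_seq1 scale1r; split=> // rg; rewrite inE => /eqP->.
by right.
Qed.

Definition IntF_scale (c : 'F_p) (q : F) : F := q *+ c.

Lemma IntF_natrFp n (q : F) : q *+ (inZp n : 'F_p) = q *+ n.
Proof.
rewrite -[in LHS](mulr_natl q) -[in RHS](mulr_natl q); congr (_ * q).
rewrite [in RHS](divn_eq n p) natrD natrM IntF_pchar mulr0 add0r.
by rewrite /= (Fp_cast p_pr).
Qed.

Lemma IntF_scaleA a b q : IntF_scale a (IntF_scale b q) = IntF_scale (a * b) q.
Proof. by rewrite /IntF_scale IntF_natrFp -mulrnA mulnC. Qed.
Lemma IntF_scale1 : left_id 1 IntF_scale.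
Proof. by move=> q; rewrite /IntF_scale mulr1n. Qed.
Lemma IntF_scaleDr : right_distributive IntF_scale +%R.
Proof. by move=> a q r; rewrite /IntF_scale mulrnDl. Qed.
Lemma IntF_scaleDl q : {morph IntF_scale^~ q : a b / a + b}.
Proof. by move=> a b; rewrite /IntF_scale IntF_natrFp mulrnDr. Qed.

HB.instance Definition _ := GRing.Zmodule_isLmodule.Build 'F_p F
  IntF_scaleA IntF_scale1 IntF_scaleDr IntF_scaleDl.

Lemma IntF_scaleAl (a : 'F_p) (q r : F) : a *: (q * r) = a *: q * r.
Proof. by rewrite /GRing.scale /= /IntF_scale mulrnAl. Qed.

HB.instance Definition _ := GRing.Lmodule_isLalgebra.Build 'F_p F IntF_scaleAl.
HB.instance Definition _ := GRing.Lalgebra_isComAlgebra.Build 'F_p F.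

(* Evaluation at the lift of a with values in {0, .., p-1}: zeta_n vanishes there
   for n >= p, so the result does not depend on the representative. *)
Definition IntF_eval (q : F) (a : X -> 'F_p) : 'F_p :=
  (IntZ_eval (repr q) (fun x => (a x : nat)%:Z))%:~R.

Definition IntF_var (x : X) : F := \pi_F (IntZ_var x).

(* The image of the polynomials in Int(Z^X) with zero constant term. *)
Definition IntF_zero_const : {pred F} :=
  fun q => `[< exists2 r, r \in @IntZ_zero_const X & \pi_F r = q >].

End IntFAlg.

Inductive coef := CoefZ | CoefF (p : nat) of prime p.

Definition coef_ring (k : coef) : comNzRingType :=
  match k with CoefZ => int | CoefF p _ => 'F_p end.

Definition IntR (k : coef) (X : choiceType) : comAlgType (coef_ring k) :=
  match k with CoefZ => IntZ X | CoefF p p_pr => IntF X p_pr end.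

Definition IntR_eval (k : coef) (X : choiceType) : IntR k X -> (X -> coef_ring k) -> coef_ring k :=
  match k with
  | CoefZ => @IntZ_eval X
  | CoefF p p_pr => @IntF_eval X p p_pr
  end.

Definition IntR_var (k : coef) (X : choiceType) : X -> IntR k X :=
  match k with
  | CoefZ => @IntZ_var X
  | CoefF p p_pr => @IntF_var X p p_pr
  end.

Definition zero_const (k : coef) (X : choiceType) : {pred IntR k X} :=
  match k with
  | CoefZ => @IntZ_zero_const X
  | CoefF p p_pr => @IntF_zero_const X p p_pr
  end.

Section AugmentationIdeal.
Variables (k : coef) (X : choiceType).

Lemma IntZ_zero_constD (q r : IntZ X) : q \in @IntZ_zero_const X ->
  r \in @IntZ_zero_const X -> q + r \in @IntZ_zero_const X.
Proof.
by rewrite !unfold_in /= mcoeffD => /eqP-> /eqP->; rewrite addr0.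
Qed.

Lemma IntZ_zero_constM (q r : IntZ X) :
  r \in @IntZ_zero_const X -> q * r \in @IntZ_zero_const X.
Proof.
rewrite !unfold_in /= => /eqP r0.
by rewrite (rmorphM (mcoeff (mone : {cmonom X}))) /= r0 mulr0.
Qed.

Lemma zero_constM (q r : IntR k X) :
  r \in @zero_const k X -> q * r \in @zero_const k X.
Proof.
case: k q r => [|p p_pr] q r; first exact: IntZ_zero_constM.
move=> /asboolP[r' r'0 <-]; apply/asboolP.
exists (repr q * r'); first exact: IntZ_zero_constM.
by rewrite rmorphM /= reprK.
Qed.

Lemma zero_constD (q r : IntR k X) : q \in @zero_const k X ->
  r \in @zero_const k X -> q + r \in @zero_const k X.
Proof.
case: k q r => [|p p_pr] q r; first exact: IntZ_zero_constD.
move=> /asboolP[q' q'0 <-] /asboolP[r' r'0 <-]; apply/asboolP.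
by exists (q' + r'); [exact: IntZ_zero_constD | rewrite rmorphD].
Qed.

Lemma zero_const0 : 0 \in @zero_const k X.
Proof.
have Z0 : 0 \in @IntZ_zero_const X by rewrite unfold_in /= mcoeff0.
case: k => [|p p_pr]; first exact: Z0.
by apply/asboolP; exists 0 => //; rewrite rmorph0.
Qed.

Lemma zero_const_closed : submod_closed (@zero_const k X).
Proof.
split=> [|a q r q0 r0]; first exact: zero_const0.
by apply: zero_constD => //; rewrite -mulr_algl zero_constM.
Qed.

HB.instance Definition _ := GRing.isSubmodClosed.Build
  (coef_ring k) (IntR k X) (@zero_const k X) zero_const_closed.

Lemma IntR_var_zero_const x : IntR_var k x \in @zero_const k X.
Proof.
have Z0 : IntZ_var x \in @IntZ_zero_const X.
  by rewrite unfold_in /= mcoeffU cm1_eq1.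
by case: k => [|p p_pr]; [exact: Z0 | apply/asboolP; exists (IntZ_var x)].
Qed.

Record maug := MkMaug { maug_val :> IntR k X; _ : maug_val \in @zero_const k X }.

HB.instance Definition _ := [isSub for maug_val].
HB.instance Definition _ := [Choice of maug by <:].
HB.instance Definition _ := [SubChoice_isSubLmodule of maug by <:].

Definition maug_mul (q r : maug) : maug :=
  MkMaug (zero_constM (maug_val q) (valP r)).

Definition maug_var (x : X) : maug := MkMaug (IntR_var_zero_const x).

End AugmentationIdeal.

Section LmodQuotient.
Variables (R : pzRingType) (V : lmodType R) (G : V -> Prop).

Lemma lspan_submod_closed : submod_closed (lspan G).
Proof.
have [[S0 SD] SZ] := lspan_closed G.
by split=> // a u v Su Sv; apply: SD => //; apply: SZ.
Qed.

HB.instance Definition _ :=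
  GRing.isSubmodClosed.Build R V (lspan G) lspan_submod_closed.

Definition lquot := Quotient.quot (lspan G : zmodClosed V).

HB.instance Definition _ := GRing.Zmodule.on lquot.

Definition lquot_scale (a : R) (u : lquot) : lquot := \pi_lquot (a *: repr u).

Lemma lquot_scale_pi a v : lquot_scale a (\pi_lquot v) = \pi_lquot (a *: v).
Proof.
apply/eqP; rewrite /lquot_scale -Quotient.idealrBE -scalerBr.
have [_ SZ] := lspan_closed G; apply: SZ.
by rewrite Quotient.idealrBE reprK.
Qed.

Lemma lquotK (u : lquot) : \pi_lquot (repr u) = u.
Proof. exact: reprK. Qed.

Lemma lquot_scaleA a b u : lquot_scale a (lquot_scale b u) = lquot_scale (a * b) u.
Proof. by rewrite -[u]lquotK !lquot_scale_pi scalerA. Qed.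
Lemma lquot_scale1 : left_id 1 lquot_scale.
Proof. by move=> u; rewrite -[u]lquotK lquot_scale_pi scale1r. Qed.
Lemma lquot_scaleDr : right_distributive lquot_scale +%R.
Proof.
move=> a u v; rewrite -[u]lquotK -[v]lquotK.
rewrite -(raddfD (\pi_lquot : {additive V -> lquot})) !lquot_scale_pi.
by rewrite scalerDr raddfD.
Qed.
Lemma lquot_scaleDl u : {morph lquot_scale^~ u : a b / a + b}.
Proof.
by move=> a b; rewrite -[u]lquotK !lquot_scale_pi scalerDl raddfD.
Qed.

HB.instance Definition _ := GRing.Zmodule_isLmodule.Build R lquot
  lquot_scaleA lquot_scale1 lquot_scaleDr lquot_scaleDl.

End LmodQuotient.

Section TensorPower.
Variables (R : comNzRingType) (U : lmodType R).

Definition tset n (t : n.-tuple U) (i : 'I_n) (u : U) : n.-tuple U :=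
  [tuple if j == i then u else tnth t j | j < n].

(* tpow n is the n-th tensor power of U: the free module on U^n modulo the
   multilinearity relations; tens t is the class of u_1 (x) ... (x) u_n. *)
Definition tens_rel n (v : {malg R[n.-tuple U]}) : Prop :=
  exists t i (r : R) u u', v =
    << tset t i (r *: u + u') >> - r *: << tset t i u >> - << tset t i u' >>.

Definition tpow (n : nat) : lmodType R := lquot (@tens_rel n).

Definition tens n (t : n.-tuple U) : tpow n := \pi_(lquot _) << t >>.

(* The linear map induced by a multilinear f, computed on a representative; see
   tlift_spec for the independence of the choice. *)
Definition tlift n (W : lmodType R) (f : n.-tuple U -> W) (u : tpow n) : W :=
  let v : {malg R[n.-tuple U]} := repr u in \sum_(t <- msupp v) v@_t *: f t.

Definition multilinear n (W : lmodType R) (f : n.-tuple U -> W) : Prop :=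
  forall t i, linear (fun u => f (tset t i u)).

Lemma tlift_spec n (W : lmodType R) (f : n.-tuple U -> W) : multilinear f ->
  linear (tlift f) /\ forall t, tlift f (tens t) = f t.
Proof.
move=> f_lin; pose ext (v : {malg R[n.-tuple U]}) := \sum_(t <- msupp v) v@_t *: f t.
have extE v (D : {fset n.-tuple U}) : (msupp v `<=` D)%fset ->
    ext v = \sum_(t <- D) v@_t *: f t.
  by move=> sub; apply: big_fset_incl => // t _ /mcoeff_outdom->; rewrite scale0r.
have ext_lin : linear ext.
  move=> r u v; pose D := (msupp u `|` msupp v `|` msupp (r *: u + v))%fset.
  rewrite !(extE _ D) ?scaler_sumr -?big_split /=.
  - by apply: eq_bigr => t _; rewrite mcoeffD mcoeffZ scalerDl scalerA.
  - by rewrite /D fsubsetU // fsubsetUr.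
  - by rewrite /D fsubsetU // fsubsetUl.
  - by rewrite /D fsubsetUr.
have ext0 : ext 0 = 0 by rewrite /ext msupp0 big_seq_fset0.
have extZ r u : ext (r *: u) = r *: ext u by rewrite -[r *: u]addr0 ext_lin ext0 addr0.
have extD u v : ext (u + v) = ext u + ext v by rewrite -{1}[u]scale1r ext_lin scale1r.
have extN u : ext (- u) = - ext u by rewrite -(scaleN1r u) extZ scaleN1r.
have extU t : ext << t >> = f t.
  by rewrite /ext msuppU oner_eq0 big_seq_fset1 mcoeffUU scale1r.
have ext_rel v : v \in lspan (@tens_rel n) -> ext v = 0.
  move=> /asboolP[s [Gs ->]]; elim: s Gs => [|[r g] s IHs] Gs.
    by rewrite big_nil.
  rewrite big_cons extD extZ IHs; last first.
    by move=> rg srg; apply: Gs; rewrite inE srg orbT.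
  have [t [i [a [u [u' /= ->]]]]] := Gs _ (mem_head _ _).
  by rewrite !extD !extN extZ !extU f_lin addrAC addrK subrr scaler0 addr0.
have ext_pi v : tlift f (\pi_(lquot (@tens_rel n)) v) = ext v.
  apply/eqP; rewrite -subr_eq0 -extN -extD; apply/eqP/ext_rel.
  by rewrite Quotient.idealrBE; apply/eqP/reprK.
split=> [r u v|t]; last by rewrite ext_pi.
rewrite -[u in LHS]lquotK -[v in LHS]lquotK [_ *: _]lquot_scale_pi.
by rewrite -(raddfD (\pi_(lquot (@tens_rel n)) : {additive _ -> _})) ext_pi ext_lin.
Qed.

End TensorPower.

Section CupOne.
Variable R : comNzRingType.

(* cup21 and circ are total functions, but they are only meaningful (and only
   constrained below) on the span decomp = D^2(A) of the products of elements of
   degree 1. *)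
Record cupone_alg := CupOneAlg {
  gr :> nat -> lmodType R;
  gr1 : gr 0;
  cup : forall i j, gr i -> gr j -> gr (i + j);
  cup1 : gr 1 -> gr 1 -> gr 1;
  cup21 : gr 2 -> gr 1 -> gr 2;
  circ : gr 2 -> gr 2 -> gr 2
}.

Definition gcast (A : cupone_alg) m n (e : m = n) (x : A m) : A n :=
  ecast i (A i) e x.

Definition degree1_map (A : cupone_alg) := forall n, A n -> A n.+1.

Variables (A : cupone_alg) (d : degree1_map A).

Definition decomp : {pred A 2} :=
  lspan (fun w : A 2 => exists a b : A 1, w = cup a b).

Definition is_graded_algebra : Prop :=
  [/\ forall i j (b : A j), linear (fun a : A i => cup a b),
      forall i j (a : A i), linear (fun b : A j => cup a b),
      forall i j l (a : A i) (b : A j) (c : A l),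
        gcast (addnA i j l) (cup a (cup b c)) = cup (cup a b) c,
      forall i (a : A i), cup (gr1 A) a = a
    & forall i (a : A i), gcast (addn0 i) (cup a (gr1 A)) = a].

Definition graded_leibniz : Prop := forall i j (a : A i) (b : A j),
  d (cup a b) =
    cup (d a) b + (-1) ^+ i *: gcast (addnS i j) (cup a (d b)).

Definition cup1_d_formula (a b : A 1) : Prop :=
  d (cup1 a b) =
    - cup a b - cup b a + cup21 (d a) b + cup21 (d b) a - circ (d a) (d b).

Definition is_dga : Prop :=
  [/\ is_graded_algebra, forall n, linear (@d n),
      forall n (a : A n), d (d a) = 0 & graded_leibniz].

Definition comm_algebra (V : lmodType R) (e : V) (mul : V -> V -> V) : Prop :=
  [/\ commutative mul, associative mul, left_id e mul
    & forall v, linear (mul v)].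

(* R (+) A^1 with multiplication cup1 on A^1. *)
Definition unitized := (R^o * A 1)%type.
HB.instance Definition _ := GRing.Lmodule.on unitized.
Definition uone : unitized := (1, 0).
Definition umul (x y : unitized) : unitized :=
  (x.1 * y.1, x.1 *: y.2 + y.1 *: x.2 + cup1 x.2 y.2).

Definition cupone_ops_linear : Prop :=
  [/\ forall b : A 1, linear (fun a => cup1 a b),
      forall a : A 1, linear (fun b => cup1 a b),
      forall r v w (b : A 1), v \in decomp -> w \in decomp ->
        cup21 (r *: v + w) b = r *: cup21 v b + cup21 w b
    & forall w, w \in decomp -> linear (fun b => cup21 w b)].

Definition circ_ops_linear : Prop :=
  [/\ forall v w, v \in decomp -> w \in decomp -> circ v w \in decomp,
      forall r u v w, u \in decomp -> v \in decomp -> w \in decomp ->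
        circ (r *: u + v) w = r *: circ u w + circ v w
    & forall r u v w, u \in decomp -> v \in decomp -> w \in decomp ->
        circ w (r *: u + v) = r *: circ w u + circ w v].

Definition cupone_axioms : Prop :=
  [/\ comm_algebra uone umul,
      forall a b c : A 1,
        cup21 (cup a b) c = cup a (cup1 b c) + cup (cup1 a c) b,
      forall u v w z : A 1,
        circ (cup u v) (cup w z) = cup (cup1 u w) (cup1 v z),
      forall (a : A 1) (c : A 0), cup1 a (d c) = cup a c - cup c a
    & forall a b : A 1, d a \in decomp -> d b \in decomp -> cup1_d_formula a b].

Definition is_cupone_dga : Prop :=
  [/\ is_dga, cupone_ops_linear, circ_ops_linear & cupone_axioms].

End CupOne.

Section Binomial.
Variable k : coef.
Local Notation R := (coef_ring k).

Definition falling (V : lmodType R) (e : V) (mul : V -> V -> V) (a : V) (n : nat) : V :=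
  \big[mul/e]_(i < n) (a - e *+ i).

Definition binomial_algebra (V : lmodType R) (e : V) (mul : V -> V -> V) : Prop :=
  comm_algebra e mul /\
  match k with
  | CoefZ =>
      (forall (a : V) n, (0 < n)%N -> a *+ n = 0 -> a = 0) /\
      (forall (a : V) n, (0 < n)%N -> exists z, z *+ n`! = falling e mul a n)
  | CoefF p _ => forall a : V, \big[mul/e]_(i < p) a = a
  end.

Definition zeta_range (n : nat) : bool :=
  (0 < n)%N && match k with CoefZ => true | CoefF p _ => (n < p)%N end.

(* The unique solution z of n! z = a (a - 1) .. (a - n + 1) in a binomial algebra
   (for n in zeta_range). *)
Definition zeta (V : lmodType R) (e : V) (mul : V -> V -> V) (n : nat) (a : V) : V :=
  xget 0 [set z | z *+ n`! = falling e mul a n].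

Definition zeta1 (A : cupone_alg R) (n : nat) (a : A 1) : A 1 :=
  (zeta (uone A) (@umul R A) n (0, a)).2.

Definition is_binomial_cupone_dga (A : cupone_alg R) (d : degree1_map A) : Prop :=
  [/\ is_cupone_dga d,
      binomial_algebra (gr1 A) (fun a b : A 0 => cup a b : A 0)
    & binomial_algebra (uone A) (@umul R A)].

Definition is_morphism (A B : cupone_alg R) (dA : degree1_map A)
    (dB : degree1_map B) (f : forall n, A n -> B n) : Prop :=
  [/\ (forall n, linear (@f n)) /\ f 0 (gr1 A) = gr1 B,
      forall i j (a : A i) (b : A j), f _ (cup a b) = cup (f _ a) (f _ b),
      forall n (a : A n), f _ (dA _ a) = dB _ (f _ a),
      forall a b : A 1, f _ (cup1 a b) = cup1 (f _ a) (f _ b)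
    & forall n (a : A 1), zeta_range n -> f _ (zeta1 n a) = zeta1 n (f _ a)].

End Binomial.

Section BarCochains.
Variables (R : comNzRingType) (M : Type) (op : M -> M -> M).

Definition simplex (n : nat) := 'I_n -> M.

(* The i-th face of (a_1, .., a_{n+1}): a_1 is dropped for i = 0, a_{n+1} for
   i = n + 1, and a_i, a_{i+1} are replaced by their product otherwise. *)
Definition bar_face n (i : 'I_n.+2) (s : simplex n.+1) : simplex n := fun j =>
  let a := s (widen_ord (leqnSn n) j) in
  let a' := s (lift ord0 j) in
  if (j.+1 < i)%N then a else if j.+1 == i :> nat then op a a' else a'.

Definition cochain (n : nat) : lmodType R := simplex n -> R^o.

Definition bar_d n (f : cochain n) : cochain n.+1 := fun s =>
  \sum_(i < n.+2) (-1) ^+ i * f (bar_face i s).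

Definition cochain_cup i j (f : cochain i) (g : cochain j) : cochain (i + j) :=
  fun s => f (fun l => s (lshift j l)) * g (fun l => s (rshift i l)).

Definition cochain_cup1 (f g : cochain 1) : cochain 1 := fun s => f s * g s.

(* On w = a U b this is a U (b U_1 c) + (a U_1 c) U b, and it is linear in w. *)
Definition cochain_cup21 (w : cochain 2) (c : cochain 1) : cochain 2 := fun s =>
  w s * (c (fun=> s ord0) + c (fun=> s ord_max)).

Definition cochain_circ (v w : cochain 2) : cochain 2 := fun s => v s * w s.

Definition bar_cochains : cupone_alg R :=
  @CupOneAlg R cochain (fun=> 1) cochain_cup cochain_cup1 cochain_cup21 cochain_circ.

End BarCochains.

Section TensorAlgebra.
Variables (k : coef) (X : choiceType).
Local Notation R := (coef_ring k).
Local Notation m := (maug k X).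
Local Notation T := (tpow m).

Definition iota1 (q : m) : T 1 := tens [tuple q].
(* The inverse of the isomorphism iota1 : m -> T^1. *)
Definition deg1 (u : T 1) : m := tlift (fun t => thead t) u.

Definition tens2 (q r : m) : T 2 := tens [tuple q; r].
Definition tlift2 (W : lmodType R) (f : m -> m -> W) : T 2 -> W :=
  tlift (fun t => f (tnth t ord0) (tnth t ord_max)).

Definition tcup i j (u : T i) (v : T j) : T (i + j) :=
  tlift (fun s => tlift (fun t => tens (cat_tuple s t)) v) u.

Definition tcup1 (u v : T 1) : T 1 := iota1 (maug_mul (deg1 u) (deg1 v)).

Definition tcup21 (w : T 2) (u : T 1) : T 2 :=
  tlift2 (fun a b => tens2 (maug_mul a (deg1 u)) b + tens2 a (maug_mul b (deg1 u))) w.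

Definition tcirc (v w : T 2) : T 2 :=
  tlift2 (fun a1 a2 =>
    tlift2 (fun b1 b2 => tens2 (maug_mul a1 b1) (maug_mul a2 b2)) w) v.

Definition tensor_alg : cupone_alg R :=
  @CupOneAlg R T (tens [tuple]) tcup tcup1 tcup21 tcirc.

Variable tau : X -> T 2.

Definition is_d_tau (d : degree1_map tensor_alg) : Prop :=
  [/\ forall n, linear (@d n),
      forall x, d _ (iota1 (maug_var k x)) = tau x,
      graded_leibniz d
    & forall a b, cup1_d_formula d a b].

(* Definite description of the d satisfying is_d_tau; the default 0 is never used,
   since such a d exists and is unique. *)
Definition d_tau : degree1_map tensor_alg :=
  if pselect (exists d, is_d_tau d) is left ex then sval (cid ex) else fun _ _ => 0.

Definition mu (a a' : X -> R) : X -> R := fun x =>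
  a x + a' x -
    tlift2 (fun q r => IntR_eval (val q) a * IntR_eval (val r) a' : R^o) (tau x).

Definition admissible : Prop := associative mu.

Definition bar_alg : cupone_alg R := bar_cochains R (X -> R).

Definition d_bar : degree1_map bar_alg := bar_d mu.

Definition extends_eval (psi : forall n, tensor_alg n -> bar_alg n) : Prop :=
  forall (q : m) (s : simplex (X -> R) 1),
    psi 1 (iota1 q) s = IntR_eval (val q) (s ord0).

End TensorAlgebra.

(* Main.v *)
From HB Require Import structures.
Require Import Defs.
From mathcomp Require Import all_boot all_order all_algebra.
From mathcomp Require Import finmap zify ring.
From mathcomp Require Import boolp classical_sets.
From mathcomp.multinomials Require Import monalg.

(* Newton interpolation at the points of a box in N^X writes the members q of any
   finite list in Int(R^X) as sums of q(a_i) e_i, with nodes a_i and elements e_i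
   common to the whole list. Tensored factor by factor, this shows that the map
   sending q_1 (x) .. (x) q_n to the cochain q_1(a_1) .. q_n(a_n) is injective and
   that a cochain c f, with c regular, comes from a tensor only if f does. Since T(X)
   is generated by X under linear combinations, cup, cup_1 and division by regular
   scalars, the image is stable under the coboundary as soon as it contains the
   coboundaries of the elements of X; these are the tau(x), by the choice of mu_tau.
   So d_tau is the coboundary transported to T(X), and every identity it has to
   satisfy is pulled back from the cochains; d_tau^2 = 0 comes from the associativity
   of mu_tau. The uniqueness statements follow from the same generation argument. *)

Set Implicit Arguments.
Unset Strict Implicit.
Unset Printing Implicit Defensive.

Import GRing.Theory Num.Theory.
Local Open Scope ring_scope.
Local Open Scope quotient_scope.

(** * Spans and interpolation *)

Lemma malgUZ (R : comNzRingType) (K : choiceType) c (x : K) :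
  << c *g x >> = c *: << x >> :> {malg R[K]}.
Proof. by apply/malgP => y; rewrite mcoeffZ !mcoeffU mulrnAr mulr1. Qed.

Lemma mem_lspan (R : pzRingType) (V : lmodType R) (G : V -> Prop) v :
  G v -> v \in lspan G.
Proof.
move=> Gv; apply/asboolP; exists [:: (1, v)]; rewrite big_seq1 scale1r.
by split=> // rg; rewrite inE => /eqP->.
Qed.

Lemma lspan_ind (R : pzRingType) (V : lmodType R) (G P : V -> Prop) : P 0 ->
    (forall c u v, G u -> v \in lspan G -> P v -> P (c *: u + v)) ->
  forall v, v \in lspan G -> P v.
Proof.
move=> P0 PS v /asboolP[s [Gs ->]]; elim: s Gs => [|[c u] s IHs] Gs.
  by rewrite big_nil.
have Gs' rg : rg \in s -> G rg.2 by move=> srg; apply: Gs; rewrite inE srg orbT.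
rewrite big_cons; apply: PS (IHs Gs'); first exact: Gs (mem_head _ _).
by apply/asboolP; exists s.
Qed.

Section BilinearOn.
Variables (R : pzRingType) (V : lmodType R).

Definition bilinear_on (D : {pred V}) (op : V -> V -> V) : Prop :=
  (forall r u v w, u \in D -> v \in D -> w \in D ->
    op (r *: u + v) w = r *: op u w + op v w) /\
  (forall r u v w, u \in D -> v \in D -> w \in D ->
    op w (r *: u + v) = r *: op w u + op w v).

Lemma lspan_closed_bilinear (G : V -> Prop) op : bilinear_on (lspan G) op ->
    (forall g h, G g -> G h -> op g h \in lspan G) ->
  forall v w, v \in lspan G -> w \in lspan G -> op v w \in lspan G.
Proof.
move=> [op_l op_r] op_gen v w Gv Gw.
have op0l u : u \in lspan G -> op 0 u = 0.
  move=> Gu; have := op_l (-1) 0 0 u (rpred0 _) (rpred0 _) Gu.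
  by rewrite scaler0 addr0 scaleN1r addNr.
have op0r u : u \in lspan G -> op u 0 = 0.
  move=> Gu; have := op_r (-1) 0 0 u (rpred0 _) (rpred0 _) Gu.
  by rewrite scaler0 addr0 scaleN1r addNr.
move: v Gv; apply: lspan_ind => [|c g v Gg Gv op_vw]; first by rewrite op0l ?rpred0.
have g_span := mem_lspan Gg; rewrite op_l // rpredD ?rpredZ // {v Gv op_vw}.
move: w Gw; apply: lspan_ind => [|d h w Gh Gw op_gw]; first by rewrite op0r ?rpred0.
have h_span := mem_lspan Gh; rewrite op_r // rpredD ?rpredZ //.
exact: op_gen.
Qed.

End BilinearOn.

Lemma linear_map0 (R : pzRingType) (V W : lmodType R) (f : V -> W) :
  linear f -> f 0 = 0.
Proof. by move=> f_lin; have /= := scalable_linear f_lin 0 0; rewrite !scale0r. Qed.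

Section Interpolation.
Variables (R : comNzRingType) (V : lmodType R) (S : Type) (ev : S -> {scalar V}).

Definition interpolates (I : finType) (p : I -> S) (e : I -> V) (v : V) : Prop :=
  v = \sum_i ev (p i) v *: e i.

Definition interpolable : Prop := forall l : seq V,
  exists (I : finType) (p : I -> S) (e : I -> V), {in l, forall v, interpolates p e v}.

Lemma interpolates_sum (I : finType) (p : I -> S) (e : I -> V)
    (J : eqType) (s : seq J) (c : J -> R) (v : J -> V) :
  {in s, forall j, interpolates p e (v j)} ->
  interpolates p e (\sum_(j <- s) c j *: v j).
Proof.
move=> ev_v; rewrite /interpolates.
under [RHS]eq_bigr do rewrite linear_sum scaler_suml.
rewrite exchange_big; apply: eq_big_seq => j sj.
rewrite [in LHS]ev_v // scaler_sumr; apply: eq_bigr => i _.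
by rewrite scalarZ scalerA.
Qed.

Hypothesis ev_interp : interpolable.

Lemma interpolable_inj u v : (forall s, ev s u = ev s v) -> u = v.
Proof.
move=> uv; have [I [p [e pe]]] := ev_interp [:: u; v].
have uE : interpolates p e u by apply: pe; rewrite inE eqxx.
have vE : interpolates p e v by apply: pe; rewrite !inE eqxx orbT.
by rewrite [LHS]uE [RHS]vE; apply: eq_bigr => i _; rewrite uv.
Qed.

(* The interpolation formula writes v through its values, so a common factor of
   the values divides v. *)
Lemma interpolable_divide c v (g : S -> R) : GRing.lreg c ->
  (forall s, ev s v = c * g s) -> exists w, forall s, ev s w = g s.
Proof.
move=> c_reg v_cg; have [I [p [e pe]]] := ev_interp [:: v].
have vE : interpolates p e v by apply: pe; rewrite inE eqxx.
have {}vE : v = c *: \sum_i g (p i) *: e i.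
  by rewrite [LHS]vE scaler_sumr; apply: eq_bigr => i _; rewrite v_cg scalerA.
by exists (\sum_i g (p i) *: e i) => s; apply: c_reg; rewrite -v_cg vE scalarZ.
Qed.

End Interpolation.

(** * Commutative and binomial algebras *)

Section AlgebraHom.
Variables (R : comNzRingType) (V W : lmodType R).
Variables (e : V) (mul : V -> V -> V) (e' : W) (mul' : W -> W -> W).

Definition algebra_hom (f : V -> W) : Prop :=
  f e = e' /\ {morph f : u v / mul u v >-> mul' u v}.

Lemma comm_algebra_pullback (I : Type) (f : I -> {linear V -> W}) :
    (forall i, algebra_hom (f i)) -> (forall u v, (forall i, f i u = f i v) -> u = v) ->
  comm_algebra e' mul' -> comm_algebra e mul.
Proof.
move=> f_hom f_inj [mulC mulA mul1 mul_lin].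
split=> [u v|u v w|u|w c u v]; apply: f_inj => i; have [f1 fM] := f_hom i.
- by rewrite !fM mulC.
- by rewrite !fM mulA.
- by rewrite fM f1 mul1.
- by rewrite fM !linearPZ !fM mul_lin.
Qed.

End AlgebraHom.

Lemma comAlg_comm_algebra (R : comNzRingType) (B : comAlgType R) :
  comm_algebra (1 : B) *%R.
Proof.
split; [exact: mulrC|exact: mulrA|exact: mul1r|move=> a c u v].
by rewrite mulrDr scalerAr.
Qed.

Lemma Fp_fact_neq0 p n : prime p -> (n < p)%N -> n`!%:R != 0 :> 'F_p.
Proof.
move=> p_pr lt_np; rewrite -(dvdn_pcharf (pchar_Fp p_pr)).
elim: n lt_np => [|n IHn] lt_np; first by rewrite dvdn1 gtn_eqF ?prime_gt1.
rewrite factS Euclid_dvdM // negb_or IHn ?andbT; last exact: ltnW.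
by rewrite gtnNdvd.
Qed.

Lemma prod_natr_sub_ffact (A : comNzRingType) m n :
  \prod_(i < n) (m%:R - i%:R) = (m ^_ n)%:R :> A.
Proof.
elim: n => [|n IHn]; first by rewrite big_ord0.
rewrite big_ord_recr IHn ffactnSr natrM /=.
have [le_nm|lt_mn] := leqP n m; first by rewrite natrB.
by rewrite ffact_small ?mul0r.
Qed.

Lemma int_falling_divisible (z : int) n :
  exists w : int, w *+ n`! = \prod_(i < n) (z - i%:R).
Proof.
case: z => m.
  exists ('C(m, n))%:Z; rewrite -mulr_natr natz -PoszM bin_ffact -natz.
  by rewrite -prod_natr_sub_ffact; apply: eq_bigr => i _; rewrite !natz.
exists ((-1) ^+ n * ('C(m + n, n))%:Z).
rewrite -mulr_natr natz -mulrA -PoszM bin_ffact.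
elim: n => [|n IHn]; first by rewrite big_ord0 addn0.
rewrite big_ord_recr -IHn addnS ffactSS /= PoszM NegzE exprS natz.
by rewrite (_ : (m + n).+1 = (m.+1 + n)%N) // PoszD; ring.
Qed.

Section CoefficientRing.
Variable k : coef.
Local Notation R := (coef_ring k).

Lemma coef_lreg (c : R) : c != 0 -> GRing.lreg c.
Proof.
case: k c => [|p p_pr] c c0; first exact: (@mulfI int).
exact: (@mulfI 'F_p).
Qed.

Lemma coef_fact_lreg n : zeta_range k n -> GRing.lreg (n`!%:R : R).
Proof.
rewrite /zeta_range => n_k; apply: coef_lreg; case: k n_k => [|p p_pr] /andP[_ n_p].
  by rewrite -[_%:R]/(n`!%:R : int) pnatr_eq0 -lt0n fact_gt0.
exact: Fp_fact_neq0.
Qed.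

End CoefficientRing.

Lemma algebra_hom_falling (k : coef) (V W : lmodType (coef_ring k))
    (e : V) mul (e' : W) mul' (f : {linear V -> W}) a n :
  algebra_hom e mul e' mul' f -> f (falling e mul a n) = falling e' mul' (f a) n.
Proof.
move=> [f1 fM]; rewrite /falling (big_morph f fM f1); apply: eq_bigr => i _.
by rewrite linearB linearMn f1.
Qed.

Lemma binomial_algebra_fact_inj (k : coef) (V : lmodType (coef_ring k)) (e : V) mul n :
  binomial_algebra e mul -> zeta_range k n -> injective (fun u : V => u *+ n`!).
Proof.
case: k V e mul => [|p p_pr] V e mul /=.
  move=> [_ [V_tfree _]] _ u v /eqP; rewrite -subr_eq0 -mulrnBl => /eqP uv.
  by apply/eqP; rewrite -subr_eq0; apply/eqP/(V_tfree _ _ (fact_gt0 n) uv).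
move=> _ /andP[_ lt_np] u v /=; rewrite -!scaler_nat.
exact/(scalerI (Fp_fact_neq0 p_pr lt_np)).
Qed.

Lemma binomial_algebra_falling (k : coef) (V : lmodType (coef_ring k)) (e : V) mul a n :
  binomial_algebra e mul -> zeta_range k n -> exists z, z *+ n`! = falling e mul a n.
Proof.
case: k V e mul a => [|p p_pr] V e mul a.
  by move=> [_ [_ V_div]] /andP[n_gt0 _]; apply: V_div.
move=> _ /andP[_ lt_np].
exists ((n`!%:R : 'F_p)^-1 *: falling (k := CoefF p_pr) e mul a n).
by rewrite -scaler_nat scalerKV ?Fp_fact_neq0.
Qed.

(* The solution of n! z = a (a - 1) .. (a - n + 1) is unique in W, so the image of
   the one selected in V is the one selected in W. *)
Lemma algebra_hom_zeta (k : coef) (V W : lmodType (coef_ring k))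
    (e : V) mul (e' : W) mul' (f : {linear V -> W}) n a :
    binomial_algebra e mul -> binomial_algebra e' mul' ->
    algebra_hom e mul e' mul' f -> zeta_range k n ->
  f (zeta e mul n a) = zeta e' mul' n (f a).
Proof.
move=> V_bin W_bin f_hom n_k; apply: (binomial_algebra_fact_inj W_bin n_k).
have zetaE (U : lmodType (coef_ring k)) (u : U) um b : binomial_algebra u um ->
    zeta u um n b *+ n`! = falling u um b n.
  move=> U_bin; exact: (@xgetPex _ 0 [set z | z *+ n`! = falling u um b n]%classic
    (binomial_algebra_falling b U_bin n_k)).
rewrite /= -(linearMn f) !zetaE //.
exact: algebra_hom_falling f_hom.
Qed.

Lemma coef_binomial_algebra (k : coef) :
  @binomial_algebra k (coef_ring k)^o 1 *%R.
Proof.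
split; first exact: comAlg_comm_algebra.
case: k => [|p p_pr].
  split=> [a n n_gt0 /eqP|a n n_gt0]; last exact: int_falling_divisible.
  by rewrite (mulrn_eq0 (a : int)) eqn0Ngt n_gt0 => /eqP.
move=> a; rewrite prodr_const card_ord.
by have := pFrobenius_aut_nat (pchar_Fp p_pr) a; rewrite pFrobenius_autE natr_Zp.
Qed.

Lemma binomial_algebra_pullback (k : coef) (V W : lmodType (coef_ring k))
    (e : V) mul (e' : W) mul' (I : Type) (f : I -> {linear V -> W}) :
    (forall i, algebra_hom e mul e' mul' (f i)) ->
    (forall u v, (forall i, f i u = f i v) -> u = v) ->
    binomial_algebra e' mul' ->
    (forall a n, zeta_range k n -> exists z, z *+ n`! = falling e mul a n) ->
  binomial_algebra e mul.
Proof.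
move=> f_hom f_inj [W_comm].
move: (comm_algebra_pullback f_hom f_inj W_comm) => V_comm.
case: k V W e mul e' mul' f f_hom f_inj V_comm {W_comm} => [|p p_pr]
    V W e mul e' mul' f f_hom f_inj V_comm.
  move=> [W_tfree _] V_div; split=> //; split=> a n n_gt0.
    move=> an0; apply: (f_inj) => i; rewrite linear0; apply: W_tfree n_gt0 _.
    by rewrite -linearMn an0 linear0.
  by apply: V_div; rewrite /zeta_range n_gt0.
move=> W_frob _; split=> // a; apply: f_inj => i; have [f1 fM] := f_hom i.
by rewrite (big_morph (f i) fM f1) W_frob.
Qed.

Lemma binomial_algebra_product (k : coef) (V W : lmodType (coef_ring k))
    (e : V) mul (e' : W) mul' (I : Type) (f : I -> {linear V -> W}) :
    (forall i, algebra_hom e mul e' mul' (f i)) ->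
    (forall u v, (forall i, f i u = f i v) -> u = v) ->
    (forall g : I -> W, exists u, forall i, f i u = g i) ->
  binomial_algebra e' mul' -> binomial_algebra e mul.
Proof.
move=> f_hom f_inj f_onto W_bin; apply: binomial_algebra_pullback => // a n n_k.
have [g gE] := choice (fun i => binomial_algebra_falling (f i a) W_bin n_k).
have [z zE] := f_onto g; exists z; apply: f_inj => i.
by rewrite linearMn zE gE (algebra_hom_falling _ _ (f_hom i)).
Qed.

(** * Homomorphisms of cup-one algebras *)

Section CupOneAlgebra.
Variables (R : comNzRingType) (A : cupone_alg R).

Lemma gcast_id n (e : n = n) (a : A n) : gcast e a = a.
Proof. by rewrite (eq_axiomK e). Qed.

Lemma leibniz_gr1 (d : degree1_map A) :
  is_graded_algebra A -> graded_leibniz d -> d _ (gr1 A) = 0.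
Proof.
move=> [_ _ _ cup1l cup1r] leib; have := leib 0%N 0%N (gr1 A) (gr1 A).
rewrite cup1l expr0 scale1r gcast_id cup1l.
have := cup1r _ (d _ (gr1 A)); rewrite gcast_id => ->.
by move=> dE; apply: (addrI (d _ (gr1 A))); rewrite addr0; exact/esym.
Qed.

Lemma circ_decomp : bilinear_on (@decomp R A) (@circ R A) ->
    (forall u v w z : A 1%N,
      circ (cup u v) (cup w z) = cup (cup1 u w) (cup1 v z) :> A 2%N) ->
  forall v w : A 2%N, v \in @decomp R A -> w \in @decomp R A ->
    circ v w \in @decomp R A.
Proof.
move=> circ_lin circ_cup; apply: lspan_closed_bilinear circ_lin _.
move=> _ _ [u [v ->]] [w [z ->]]; rewrite circ_cup.
by apply: mem_lspan; exists (cup1 u w), (cup1 v z).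
Qed.

End CupOneAlgebra.

Section CupOneHom.
Variables (R : comNzRingType) (A B : cupone_alg R) (f : forall n, {linear A n -> B n}).

Lemma gcast_hom i j (e : i = j) (a : A i) : f j (gcast e a) = gcast e (f i a).
Proof. by case: j / e. Qed.

Definition cupone_hom : Prop :=
  [/\ f _ (gr1 A) = gr1 B,
      forall i j (a : A i) (b : A j), f _ (cup a b) = cup (f _ a) (f _ b),
      {morph f 1%N : a b / cup1 a b},
      forall (w : A 2%N) (a : A 1%N), f _ (cup21 w a) = cup21 (f _ w) (f _ a)
    & {morph f 2%N : v w / circ v w}].

Definition unitized_map (x : unitized A) : unitized B := (x.1, f 1%N x.2).

Lemma unitized_map_is_linear : linear unitized_map.
Proof. by move=> c x y; congr pair; rewrite /= linearPZ. Qed.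

HB.instance Definition _ := GRing.isLinear.Build R (unitized A) (unitized B) _
  unitized_map unitized_map_is_linear.

Hypothesis f_hom : cupone_hom.

Lemma hom_leibniz_rhs i j (a : A i) (b : A j) (da : A i.+1) (db : A j.+1) :
  f _ (cup da b + (-1) ^+ i *: gcast (addnS i j) (cup a db)) =
  cup (f _ da) (f _ b) + (-1) ^+ i *: gcast (addnS i j) (cup (f _ a) (f _ db)).
Proof.
have [_ f_cup _ _ _] := f_hom.
by rewrite linearD linearZZ gcast_hom !f_cup.
Qed.

Lemma hom_cup1_d_rhs (a b : A 1%N) (da db : A 2%N) :
  f _ (- cup a b - cup b a + cup21 da b + cup21 db a - circ da db) =
  - cup (f _ a) (f _ b) - cup (f _ b) (f _ a) + cup21 (f _ da) (f _ b)
    + cup21 (f _ db) (f _ a) - circ (f _ da) (f _ db).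
Proof.
have [_ f_cup _ f_cup21 f_circ] := f_hom.
by rewrite linearB f_circ !linearD !f_cup21 !linearN (f_cup _ _ a b) (f_cup _ _ b a).
Qed.

Lemma unitized_map_hom :
  algebra_hom (uone A) (@umul R A) (uone B) (@umul R B) unitized_map.
Proof.
have [_ _ f_cup1 _ _] := f_hom.
by split=> [|x y]; congr pair; rewrite /= ?linear0 // !linearD !linearZZ f_cup1.
Qed.

Lemma cupone_hom_decomp w : w \in @decomp R A -> f _ w \in @decomp R B.
Proof.
have [_ f_cup _ _ _] := f_hom.
move: w; apply: lspan_ind => [|c _ v [a [b ->]] _ fv_dec].
  by rewrite linear0 rpred0.
rewrite linearPZ rpredD ?rpredZ //.
by apply: mem_lspan; exists (f _ a), (f _ b); rewrite f_cup.
Qed.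

End CupOneHom.

Section Differentials.
Variables (R : comNzRingType) (A B : cupone_alg R) (f : forall n, {linear A n -> B n}).
Variables (dA : degree1_map A) (dB : degree1_map B).
Hypothesis f_hom : cupone_hom f.

Section CommutationLocus.
Hypothesis dA_linear : forall n, linear (@dA n).
Hypothesis dB_linear : forall n, linear (@dB n).

Definition commutes_at n (a : A n) : Prop := f _ (dA a) = dB (f _ a).

Lemma commutes_at0 n : commutes_at (0 : A n).
Proof.
rewrite /commutes_at (linear_map0 (@dA_linear n)) !linear0.
by rewrite (linear_map0 (@dB_linear n)).
Qed.

Lemma commutes_at_comb n c (a b : A n) :
  commutes_at a -> commutes_at b -> commutes_at (c *: a + b).
Proof. by rewrite /commutes_at dA_linear !linearPZ dB_linear => -> ->. Qed.

Lemma commutes_at_divide n c (a : A n) :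
    injective ( *:%R c : B n.+1 -> B n.+1) -> commutes_at (c *: a) -> commutes_at a.
Proof.
move=> c_inj; rewrite /commutes_at (scalable_linear (@dA_linear _)) !linearZZ.
by rewrite (scalable_linear (@dB_linear _)) => /c_inj.
Qed.

Lemma commutes_at_cup i j (a : A i) (b : A j) :
    graded_leibniz dA -> graded_leibniz dB ->
  commutes_at a -> commutes_at b -> commutes_at (cup a b).
Proof.
have [_ f_cup _ _ _] := f_hom; rewrite /commutes_at => leibA leibB fa fb.
by rewrite leibA hom_leibniz_rhs // f_cup leibB fa fb.
Qed.

Lemma commutes_at_cup1 (a b : A 1%N) :
    cup1_d_formula dA a b -> cup1_d_formula dB (f _ a) (f _ b) ->
  commutes_at a -> commutes_at b -> commutes_at (cup1 a b).
Proof.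
have [_ _ f_cup1 _ _] := f_hom; rewrite /commutes_at => dA_cup1 dB_cup1 fa fb.
by rewrite dA_cup1 hom_cup1_d_rhs // f_cup1 dB_cup1 fa fb.
Qed.

Lemma commutes_at_gr1 : dA (gr1 A) = 0 -> dB (gr1 B) = 0 -> commutes_at (gr1 A).
Proof.
have [f1 _ _ _ _] := f_hom.
by rewrite /commutes_at f1 => -> ->; rewrite linear0.
Qed.

End CommutationLocus.

Lemma exists_pullback_d : (forall n (a : A n), exists w, f _ w = dB (f _ a)) ->
  exists d : degree1_map A, forall n (a : A n), f _ (d n a) = dB (f _ a).
Proof.
move=> dB_im; exists (fun n a => sval (cid (dB_im n a))) => n a.
exact: svalP (cid (dB_im n a)).
Qed.

Section Pullback.
Hypothesis f_inj : forall n, injective (f n).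
Hypothesis f_d : forall n (a : A n), f _ (dA a) = dB (f _ a).

Lemma pullback_graded_algebra : is_graded_algebra B -> is_graded_algebra A.
Proof.
have [f1 f_cup _ _ _] := f_hom; move=> [cupl cupr cupA cup1l cup1r]; split.
- by move=> i j b r a a'; apply: f_inj; rewrite linearPZ !f_cup linearPZ cupl.
- by move=> i j a r b b'; apply: f_inj; rewrite linearPZ !f_cup linearPZ cupr.
- by move=> i j l a b c; apply: f_inj; rewrite gcast_hom !f_cup cupA.
- by move=> i a; apply: f_inj; rewrite (f_cup _ _ (gr1 A) a) f1 cup1l.
- by move=> i a; apply: f_inj; rewrite gcast_hom f_cup f1 cup1r.
Qed.

Lemma pullback_d_linear : (forall n, linear (@dB n)) -> forall n, linear (@dA n).
Proof.
by move=> dB_lin n r a b; apply: f_inj; rewrite linearPZ !f_d linearPZ dB_lin.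
Qed.

Lemma pullback_leibniz : graded_leibniz dB -> graded_leibniz dA.
Proof.
have [_ f_cup _ _ _] := f_hom; move=> leib i j a b; apply: f_inj.
by rewrite hom_leibniz_rhs // f_d f_cup leib !f_d.
Qed.

Lemma pullback_cup1_d (a b : A 1%N) :
  cup1_d_formula dB (f _ a) (f _ b) -> cup1_d_formula dA a b.
Proof.
have [_ _ f_cup1 _ _] := f_hom; move=> dB_cup1; apply: f_inj.
by rewrite hom_cup1_d_rhs // f_d f_cup1 dB_cup1 !f_d.
Qed.

Lemma pullback_dga : is_dga dB -> is_dga dA.
Proof.
move=> [B_alg dB_lin dBdB leib]; split; first exact: pullback_graded_algebra.
- exact: pullback_d_linear.
- by move=> n a; apply: f_inj; rewrite !f_d dBdB linear0.
- exact: pullback_leibniz.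
Qed.

Lemma pullback_unitized_comm :
  comm_algebra (uone B) (@umul R B) -> comm_algebra (uone A) (@umul R A).
Proof.
apply: (comm_algebra_pullback (I := unit) (f := fun _ => unitized_map f)) => [_|x y xy].
  exact: unitized_map_hom.
by case: x y xy => [r a] [s b] /(_ tt) [-> /f_inj->].
Qed.

Lemma pullback_cupone_dga : is_cupone_dga dB -> is_cupone_dga dA.
Proof.
have [_ f_cup f_cup1 f_cup21 f_circ] := f_hom; have f_dec := cupone_hom_decomp f_hom.
move=> [B_dga [cup1l cup1r cup21l cup21r] [_ circ_l circ_r]].
move=> [B_comm cup21E circE cup1_d0 cup1_d].
have circ_linA : bilinear_on (@decomp R A) (@circ R A).
  by split=> *; apply: f_inj;
    rewrite linearPZ !f_circ linearPZ (circ_l, circ_r) ?f_dec.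
have circEA (u v w z : A 1%N) :
    circ (cup u v) (cup w z) = cup (cup1 u w) (cup1 v z) :> A 2%N.
  by apply: f_inj;
    rewrite f_circ (f_cup _ _ u v) (f_cup _ _ w z) circE -!f_cup1 -f_cup.
split; first exact: pullback_dga.
- split.
  + by move=> b r a a'; apply: f_inj; rewrite linearPZ !f_cup1 linearPZ cup1l.
  + by move=> a r b b'; apply: f_inj; rewrite linearPZ !f_cup1 linearPZ cup1r.
  + by move=> r v w b v_dec w_dec; apply: f_inj;
      rewrite linearPZ !f_cup21 linearPZ cup21l ?f_dec.
  + by move=> w w_dec r a b; apply: f_inj;
      rewrite linearPZ !f_cup21 linearPZ cup21r ?f_dec.
- by have [circ_lA circ_rA] := circ_linA; split=> //; apply: circ_decomp.
split=> //; first exact: pullback_unitized_comm.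
- move=> a b c; apply: f_inj; rewrite f_cup21 (f_cup _ _ a b) cup21E -!f_cup1.
  by rewrite -(f_cup _ _ a) -(f_cup _ _ _ b) -linearD.
- move=> a c; apply: f_inj.
  by rewrite linearB f_cup1 f_d cup1_d0 (f_cup _ _ a c) (f_cup _ _ c a).
- move=> a b /f_dec; rewrite f_d => fa_dec /f_dec; rewrite f_d => fb_dec.
  exact/pullback_cup1_d/cup1_d.
Qed.

End Pullback.
End Differentials.

Lemma cupone_hom_zeta1 (k : coef) (A B : cupone_alg (coef_ring k))
    (f : forall n, {linear A n -> B n}) n (a : A 1%N) : cupone_hom f ->
    binomial_algebra (uone A) (@umul _ A) -> binomial_algebra (uone B) (@umul _ B) ->
    zeta_range k n ->
  f _ (zeta1 n a) = zeta1 n (f _ a).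
Proof.
move=> f_hom A_bin B_bin n_k; have := algebra_hom_zeta (f := unitized_map f) (0, a)
  A_bin B_bin (unitized_map_hom f_hom) n_k.
by move=> /(congr1 snd).
Qed.

(** * The bar complex *)

Section BarComplex.
Variables (R : comNzRingType) (M : Type) (op : M -> M -> M).
Local Notation C := (cochain R M).
Local Notation A := (bar_cochains R M).

Lemma cochainP n (f g : C n) : (forall s, f s = g s :> R) -> f = g.
Proof. exact: funext. Qed.

Lemma cochainD n (f g : C n) s : (f + g) s = (f s : R) + g s. Proof. by []. Qed.
Lemma cochainN n (f : C n) s : (- f) s = - (f s : R). Proof. by []. Qed.
Lemma cochainZ n r (f : C n) s : (r *: f) s = r * f s. Proof. by []. Qed.
Lemma cochain0 n s : (0 : C n) s = 0 :> R. Proof. by []. Qed.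
Definition cochainE := (cochainD, cochainN, cochainZ, cochain0).

Lemma cochain_scale_inj n c : GRing.lreg c -> injective (fun f : C n => c *: f).
Proof.
move=> c_reg f g fg; apply: cochainP => s; apply: c_reg.
exact: (congr1 (fun h : C n => h s) fg).
Qed.

Lemma bar_cup1E (f g : A 1%N) s : cup1 f g s = (f s : R) * g s.
Proof. by []. Qed.

Lemma bar_cup21E (w : A 2%N) (f : A 1%N) s :
  cup21 w f s = (w s : R) * ((f (fun=> s ord0) : R) + f (fun=> s ord_max)).
Proof. by []. Qed.

Lemma bar_circE (v w : A 2%N) s : circ v w s = (v s : R) * w s.
Proof. by []. Qed.

Lemma bar_cupE i j (f : A i) (g : A j) s :
  cup f g s = (f (fun l => s (lshift j l)) : R) * g (fun l => s (rshift i l)).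
Proof. by []. Qed.

Lemma bar_cup11E (f g : A 1%N) (s : simplex M 2) :
  (cup f g : A 2%N) s = (f (fun=> s ord0) : R) * g (fun=> s ord_max).
Proof.
by rewrite bar_cupE; congr (f _ * g _); apply: funext => i; rewrite ord1;
  congr s; apply: val_inj.
Qed.

Lemma bar_gcastE m n (e : m = n) (f : A m) s :
  gcast e f s = f (fun i => s (cast_ord e i)) :> R.
Proof.
by case: n / e s => s; congr (f _); apply: funext => i; congr s; apply: val_inj.
Qed.

(* Positive-dimensional simplices are handled as restrictions of sequences indexed
   by [nat], which removes all ordinal arithmetic from the face identities. *)
Definition restr n (s : nat -> M) : simplex M n := fun i => s i.
Arguments restr n s i : clear implicits.

Lemma restr_surj n (s : simplex M n.+1) : exists s', s = restr n.+1 s'.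
Proof.
exists (fun l => if insub l is Some i then s i else s ord0).
by apply: funext => i; rewrite /restr valK.
Qed.

Lemma cochain_restrP n (f g : C n.+1) :
  (forall s, f (restr n.+1 s) = g (restr n.+1 s)) -> f = g.
Proof. by move=> fg; apply: funext => s; have [s' ->] := restr_surj s. Qed.

Definition seq_face (i : nat) (s : nat -> M) : nat -> M := fun l =>
  if (l.+1 < i)%N then s l else if l.+1 == i then op (s l) (s l.+1) else s l.+1.

Definition seq_shift (i : nat) (s : nat -> M) : nat -> M := fun l => s (i + l)%N.

Lemma bar_dE n (f : C n) s :
  bar_d op f (restr n.+1 s) =
    \sum_(0 <= i < n.+2) (-1) ^+ i * f (restr n (seq_face i s)).
Proof. by rewrite big_mkord. Qed.

Lemma bar_cup_restr i j (f : A i) (g : A j) s :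
  cup f g (restr _ s) = (f (restr i s) : R) * g (restr j (seq_shift i s)).
Proof. by []. Qed.

Lemma restr_face_high n i s : (n < i)%N -> restr n (seq_face i s) = restr n s.
Proof.
move=> lt_ni; apply: funext => l; rewrite /restr /seq_face ifT //.
exact: leq_ltn_trans (ltn_ord l) lt_ni.
Qed.

Lemma shift_face_low i l s : (l <= i)%N ->
  seq_shift i (seq_face l s) = seq_shift i.+1 s.
Proof.
move=> le_li; apply: funext => q; rewrite /seq_shift /seq_face addSn.
by rewrite ifF ?ifF //; lia.
Qed.

Lemma shift_face_high i l s :
  seq_shift i (seq_face (i + l.+1) s) = seq_face l.+1 (seq_shift i s).
Proof.
by apply: funext => q; rewrite /seq_shift /seq_face -addnS ltn_add2l eqn_add2l.
Qed.

Lemma face0_shift i s : seq_face 0 (seq_shift i s) = seq_shift i.+1 s.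
Proof. by apply: funext => l; rewrite /seq_face /seq_shift addSnnS. Qed.

Lemma bar_d_linear n : linear (@bar_d R M op n).
Proof.
move=> r f g; apply: cochainP => s; rewrite !cochainE /bar_d mulr_sumr -big_split.
by apply: eq_bigr => i _; rewrite !cochainE mulrDr mulrCA.
Qed.

Lemma bar_d0E (f : C 0) : bar_d op f = 0.
Proof.
apply: cochain_restrP => s; rewrite bar_dE !big_nat_recr //= big_geq // add0r.
rewrite expr0 expr1 mulN1r mul1r (_ : restr 0 _ = restr 0 (seq_face 1 s)) ?subrr //.
by apply: funext => -[].
Qed.

Lemma bar_d1E (f : C 1) (s : simplex M 2) :
  bar_d op f s = f (fun=> s ord_max) - f (fun=> op (s ord0) (s ord_max))
                 + f (fun=> s ord0).
Proof.
have restr1 t : restr 1 t = fun=> t 0 by apply: funext => i; rewrite /restr ord1.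
have [s' ->] := restr_surj s; rewrite bar_dE.
rewrite !big_nat_recr //= big_geq // add0r !restr1 /seq_face /=.
by rewrite expr0 expr1 sqrrN expr1n !mul1r mulN1r.
Qed.

Lemma bar_leibniz : graded_leibniz (@bar_d R M op : degree1_map A).
Proof.
move=> i j f g; apply: cochain_restrP => s.
transitivity (bar_d op f (restr i.+1 s) * g (restr j (seq_shift i.+1 s))
    + (-1) ^+ i * (f (restr i s) * bar_d op g (restr j.+1 (seq_shift i s))));
  last by rewrite !cochainE bar_gcastE.
rewrite !bar_dE.
have low_faces : \sum_(0 <= l < i.+1)
      (-1) ^+ l * (cup f g : A (i + j)) (restr (i + j) (seq_face l s))
    = (\sum_(0 <= l < i.+1) (-1) ^+ l * f (restr i (seq_face l s)))
      * g (restr j (seq_shift i.+1 s)).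
  rewrite mulr_suml !big_mkord; apply: eq_bigr => l _.
  by rewrite (bar_cup_restr f g) mulrA shift_face_low // -ltnS.
have high_faces : \sum_(i.+1 <= l < (i + j).+2)
      (-1) ^+ l * (cup f g : A (i + j)) (restr (i + j) (seq_face l s))
    = (-1) ^+ i * (f (restr i s) * \sum_(0 <= l < j.+1) (-1) ^+ l.+1 *
        g (restr j (seq_face l.+1 (seq_shift i s)))).
  rewrite -{1}[i.+1]add0n (_ : (i + j).+2 = (j.+1 + i.+1)%N); last by lia.
  rewrite big_addn addnK !mulr_sumr; apply: eq_bigr => l _.
  rewrite (_ : l + i.+1 = i + l.+1)%N; last by lia.
  rewrite (bar_cup_restr f g) shift_face_high restr_face_high; last by lia.
  by rewrite exprD -!mulrA [f _ * (_ * _)]mulrCA.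
rewrite (@big_cat_nat _ _ _ i.+1) //=; last by lia.
rewrite low_faces high_faces.
rewrite [in RHS]big_nat_recr // [X in _ = _ + _ * (_ * X)]big_nat_recl //=.
by rewrite (restr_face_high _ (ltnSn i)) face0_shift exprS; ring.
Qed.

Lemma bar_cup1_d (f g : A 1%N) :
  cup1_d_formula (@bar_d R M op : degree1_map A) f g.
Proof.
apply: cochainP => s.
rewrite !cochainE !bar_cup21E bar_circE !bar_d1E !bar_cup11E !bar_cup1E; ring.
Qed.

Lemma bar_graded_algebra : is_graded_algebra A.
Proof.
split.
- move=> i j g r f f'; apply: cochainP => s.
  by rewrite !cochainE !bar_cupE !cochainE; ring.
- move=> i j f r g g'; apply: cochainP => s.
  by rewrite !cochainE !bar_cupE !cochainE; ring.
- move=> i j l f g h; apply: cochainP => s; rewrite bar_gcastE !bar_cupE mulrA.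
  by congr (f _ * g _ * h _); apply: funext => q; congr s; apply: val_inj;
    rewrite /= ?addnA.
- move=> i f; apply: cochainP => s; rewrite bar_cupE mul1r.
  by congr (f _); apply: funext => q; congr s; apply: val_inj.
- move=> i f; apply: cochainP => s; rewrite bar_gcastE bar_cupE mulr1.
  by congr (f _); apply: funext => q; congr s; apply: val_inj.
Qed.

Definition unitized_eval (i : option (simplex M 1)) (x : unitized A) : R :=
  (x.1 : R) + oapp x.2 0 i.

Lemma unitized_eval_is_scalar i : scalar (unitized_eval i).
Proof.
move=> c [r f] [r' g]; rewrite /unitized_eval /= -[c *: r + r']/(c * r + r' : R).
by case: i => [s|] /=; rewrite ?cochainE; ring.
Qed.

HB.instance Definition _ i := GRing.isLinear.Build R (unitized A) R *%R
  (unitized_eval i) (unitized_eval_is_scalar i).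

Lemma unitized_eval_hom i :
  algebra_hom (W := R^o) (uone A) (@umul R A) 1 *%R (unitized_eval i).
Proof.
split=> [|[r f] [r' g]]; rewrite /unitized_eval.
  by case: i => [s|] /=; rewrite ?cochainE addr0.
case: i => [s|]; last by rewrite /= !addr0.
by rewrite -[LHS]/(r * r' + (r * g s + r' * f s + f s * g s) : R) /=; ring.
Qed.

Lemma unitized_eval_inj x y :
  (forall i, unitized_eval i x = unitized_eval i y) -> x = y.
Proof.
case: x y => [r f] [r' g] fg.
have /= r_eq := fg None; rewrite /unitized_eval /= !addr0 in r_eq.
congr pair => //; apply: funext => s.
by have := fg (Some s); rewrite /unitized_eval /= r_eq => /addrI.
Qed.

Lemma bar_unitized_comm : comm_algebra (uone A) (@umul R A).
Proof.
exact: (comm_algebra_pullback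
  (f := fun i => unitized_eval i : {linear unitized A -> R^o})
  unitized_eval_hom unitized_eval_inj (comAlg_comm_algebra R^o)).
Qed.

Hypothesis opA : associative op.

Lemma seq_face_face i j s : (i <= j)%N ->
  seq_face j (seq_face i s) = seq_face i (seq_face j.+1 s).
Proof.
move=> le_ij; apply: funext => l; rewrite /seq_face.
by repeat (case: ifP => ?); try lia; rewrite ?opA.
Qed.

Lemma alternating_double_sum n (G : nat -> nat -> R) :
    (forall i j, (i <= j)%N -> G i j = G j.+1 i) ->
  \sum_(0 <= i < n.+1) (-1) ^+ i * (\sum_(0 <= j < n) (-1) ^+ j * G i j) = 0.
Proof.
move=> GE; elim: n => [|n IHn]; first by rewrite big_nat1 big_geq ?mulr0.
rewrite big_nat_recr //=.
under eq_bigr => i _ do rewrite big_nat_recr //= mulrDr.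
rewrite big_split /= IHn add0r mulr_sumr -big_split big_nat big1 //= => i lt_in.
by rewrite GE // exprS; ring.
Qed.

Lemma bar_d_d n (f : C n) : bar_d op (bar_d op f) = 0.
Proof.
apply: cochain_restrP => s; rewrite bar_dE.
under eq_bigr => i _ do rewrite bar_dE.
apply: (@alternating_double_sum n.+2
  (fun i j => f (restr n (seq_face j (seq_face i s))))).
by move=> i j le_ij; rewrite seq_face_face.
Qed.

Lemma bar_dga : is_dga (@bar_d R M op : degree1_map A).
Proof.
split; first exact: bar_graded_algebra.
- by move=> n; apply: bar_d_linear.
- exact: bar_d_d.
- exact: bar_leibniz.
Qed.

Lemma bar_cup1_d0 (f : A 1%N) (c : A 0%N) : cup1 f (bar_d op c) = cup f c - cup c f.
Proof.
apply: cochainP => s; rewrite bar_d0E bar_cup1E !cochainE !bar_cupE mulr0.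
rewrite [X in _ - X]mulrC; apply/esym/eqP; rewrite subr_eq0; apply/eqP.
by congr (f _ * c _); apply: funext => -[i lt_i] //; congr s; apply: val_inj.
Qed.

Lemma bar_cupone_dga : is_cupone_dga (@bar_d R M op : degree1_map A).
Proof.
have circ_lin : bilinear_on (@decomp R A) (@circ R A).
  by split=> r u v w _ _ _; apply: cochainP => s;
    rewrite !cochainE !bar_circE !cochainE; ring.
have circ_cup (u v w z : A 1%N) :
    circ (cup u v) (cup w z) = cup (cup1 u w) (cup1 v z) :> A 2%N.
  by apply: cochainP => s; rewrite bar_circE !bar_cup11E !bar_cup1E; ring.
split; first exact: bar_dga.
- split.
  + move=> g r f f'; apply: cochainP => s.
    by rewrite !cochainE !bar_cup1E !cochainE; ring.
  + move=> f r g g'; apply: cochainP => s.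
    by rewrite !cochainE !bar_cup1E !cochainE; ring.
  + move=> r v w f _ _; apply: cochainP => s.
    by rewrite !cochainE !bar_cup21E !cochainE; ring.
  + move=> w _ r f g; apply: cochainP => s.
    by rewrite !cochainE !bar_cup21E !cochainE; ring.
- by have [circ_l circ_r] := circ_lin; split=> //; apply: circ_decomp.
split=> //; first exact: bar_unitized_comm.
- move=> f g h; apply: cochainP => s.
  by rewrite !cochainE bar_cup21E !bar_cup11E !bar_cup1E; ring.
- exact: bar_cup1_d0.
- by move=> f g _ _; apply: bar_cup1_d.
Qed.

End BarComplex.

Section BarBinomial.
Variables (k : coef) (M : Type).
Local Notation A := (bar_cochains (coef_ring k) M).

Lemma bar_deg0_binomial :
  binomial_algebra (gr1 A) (fun a b : A 0%N => cup a b : A 0%N).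
Proof.
pose ev (s : simplex M 0) (f : A 0%N) : coef_ring k := f s.
have ev_scalar s : scalar (ev s) by [].
pose evl s : {linear A 0%N -> (coef_ring k)^o} := HB.pack (ev s)
  (GRing.isLinear.Build _ (A 0%N) (coef_ring k)^o _ (ev s) (ev_scalar s)).
have simplex0 (s t : simplex M 0) : s = t by apply: funext => -[].
apply: (binomial_algebra_product (f := evl) _ _ _ (coef_binomial_algebra k)).
- move=> s; split=> // f g; rewrite -[LHS]/((cup f g : A 0%N) s) bar_cupE.
  by congr (f _ * g _); apply: simplex0.
- exact: funext.
- by move=> g; exists g.
Qed.

Lemma bar_unitized_binomial : binomial_algebra (uone A) (@umul _ A).
Proof.
apply: (binomial_algebra_product
  (f := fun i => unitized_eval i : {linear unitized A -> (coef_ring k)^o})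
  (@unitized_eval_hom _ M) (@unitized_eval_inj _ M) _ (coef_binomial_algebra k)).
move=> g; exists ((g None, fun s => g (Some s) - g None) : unitized A).
by case=> [s|]; rewrite /unitized_eval /=; [exact: subrKC|exact: addr0].
Qed.

End BarBinomial.

(** * Interpolation by integer-valued polynomials *)

Section NewtonInterpolation.
Variable F : numFieldType.

Definition bin_poly (n : nat) : {poly F} :=
  (n`!%:R)^-1 *: \prod_(i < n) ('X - i%:R%:P).

Definition newton_coef (n b : nat) : int := (('X - 1) ^+ n : {poly int})`_b.

(* The Lagrange polynomial of the node b among 0, .., N - 1, in the Newton basis:
   expanding 'X^j = (1 + ('X - 1))^j shows that the coefficients of the powers of
   'X - 1 form the inverse of the Pascal matrix. *)
Definition lagrange_poly (N b : nat) : {poly F} :=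
  \sum_(n < N) (newton_coef n b)%:~R *: bin_poly n.

Lemma newton_coef_gt n b : (n < b)%N -> newton_coef n b = 0.
Proof. by move=> lt_nb; rewrite /newton_coef nth_default // size_exp_XsubC. Qed.

Lemma newton_coef_pascal N b j : (j < N)%N ->
  \sum_(n < N) newton_coef n b * 'C(j, n)%:R = (b == j)%:R.
Proof.
move=> lt_jN; have := exprDn (1 : {poly int}) ('X - 1) j; rewrite addrCA subrr addr0.
move=> /(congr1 (coefp b)); rewrite /= coefXn coef_sum => ->.
rewrite (big_ord_widen N (fun n => (1 ^+ (j - n) * ('X - 1) ^+ n *+ 'C(j, n))`_b)) //.
rewrite [RHS]big_mkcond; apply: eq_bigr => n _; rewrite expr1n mul1r coefMn mulr_natr.
by case: ltnP => // lt_jn; rewrite bin_small.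
Qed.

Lemma bin_poly_nat n j : (bin_poly n).[j%:R] = 'C(j, n)%:R.
Proof.
rewrite /bin_poly hornerZ horner_prod.
under eq_bigr => i _ do rewrite !hornerE.
rewrite prod_natr_sub_ffact -bin_ffact natrM mulrC mulfK //.
by rewrite pnatr_eq0 -lt0n fact_gt0.
Qed.

Lemma size_lagrange_poly N b : (size (lagrange_poly N b) <= N)%N.
Proof.
apply: leq_trans (size_sum _ _ _) _; apply/bigmax_leqP => n _.
do 2!apply: leq_trans (size_scale_leq _ _) _.
by rewrite size_prod_XsubC /index_enum -enumT size_enum_ord.
Qed.

Lemma lagrange_poly_nat N b j : (j < N)%N -> (lagrange_poly N b).[j%:R] = (b == j)%:R.
Proof.
move=> lt_jN; rewrite /lagrange_poly horner_sum.
have := congr1 (intr : int -> F) (newton_coef_pascal b lt_jN).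
rewrite rmorph_nat rmorph_sum => <-; apply: eq_bigr => n _.
by rewrite hornerZ bin_poly_nat rmorphM rmorph_nat.
Qed.

Lemma lagrange_interpolation N (p : {poly F}) : (size p <= N)%N ->
  p = \sum_(b < N) p.[b%:R] *: lagrange_poly N b.
Proof.
move=> size_p; apply/eqP; rewrite -subr_eq0; apply/eqP.
apply: (@roots_geq_poly_eq0 _ _ [seq j%:R | j <- iota 0 N]).
- apply/allP => y /mapP[j]; rewrite mem_iota add0n => /andP[_ lt_jN] ->.
  rewrite /root !hornerE horner_sum (bigD1 (Ordinal lt_jN)) //= big1 => [|b].
    by rewrite hornerZ lagrange_poly_nat // eqxx mulr1 addr0 subrr.
  rewrite -val_eqE /= => /negPf ne_bj.
  by rewrite hornerZ lagrange_poly_nat // ne_bj mulr0.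
- by rewrite map_inj_uniq ?iota_uniq // => i j /eqP; rewrite eqr_nat => /eqP.
rewrite size_map size_iota (leq_trans (size_polyD _ _)) // geq_max size_p size_polyN.
apply: leq_trans (size_sum _ _ _) _; apply/bigmax_leqP => b _.
exact: leq_trans (size_scale_leq _ _) (size_lagrange_poly _ _).
Qed.

End NewtonInterpolation.

Section IntegerValuedInterpolation.
Variable X : choiceType.

Lemma qbinom_var_intvalued (x : X) n : qbinom (qvar x) n \in @intvalued X.
Proof.
have n_fact : n`!%:R != 0 :> rat by rewrite pnatr_eq0 -lt0n fact_gt0.
apply/asboolP => a; have [w wE] := int_falling_divisible (a x) n; exists w.
rewrite /qbinom -mul_malgC rmorphM rmorph_prod /= [X in X * _]mmapC.
under eq_bigr => i _ do rewrite rmorphB rmorph_nat /= qeval_var.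
apply: (mulfI n_fact); rewrite mulrA mulfV // mul1r mulr_natl -rmorphMn /= wE.
by rewrite rmorph_prod; apply: eq_bigr => i _; rewrite rmorphB rmorph_nat.
Qed.

Definition IntZ_binom (x : X) (n : nat) : IntZ X := MkIntZ (qbinom_var_intvalued x n).

Lemma IntZ_valZ (n : int) (q : IntZ X) : IntZ_val (n *: q) = n%:~R *: IntZ_val q.
Proof. by rewrite !scaler_int -(rmorphMz (val : {rmorphism IntZ X -> Qpoly X})). Qed.

Lemma IntZ_binom_fact (x : X) n :
  n`!%:R *: IntZ_binom x n = \prod_(i < n) (IntZ_var x - i%:R).
Proof.
have n_fact : n`!%:R != 0 :> rat by rewrite pnatr_eq0 -lt0n fact_gt0.
apply: val_inj; rewrite natz rmorph_prod [LHS]IntZ_valZ [LHS]scalerA mulfV // scale1r.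
by apply: eq_bigr => i _; rewrite rmorphB rmorph_nat.
Qed.

Definition IntZ_lagrange N (x : X) (b : nat) : IntZ X :=
  \sum_(n < N) newton_coef n b *: IntZ_binom x n.

Lemma IntZ_lagrange_horner N x b :
  IntZ_val (IntZ_lagrange N x b) = horner_alg (qvar x) (lagrange_poly rat N b).
Proof.
rewrite -[LHS]/(val _) /IntZ_lagrange /lagrange_poly !rmorph_sum /=.
apply: eq_bigr => n _.
rewrite linearZ IntZ_valZ /= mulr_algl; congr (_ *: _).
rewrite /bin_poly linearZ /= mulr_algl rmorph_prod /qbinom; congr (_ *: _).
by apply: eq_bigr => i _; rewrite rmorphB /= horner_algX polyCMn rmorph_nat.
Qed.

Lemma cmonom_prod (m : {cmonom X}) (D : {fset X}) : (finsupp m `<=` D)%fset ->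
  m = \big[mmul/mone]_(x <- D) \big[mmul/mone]_(i < m x) ucm x.
Proof.
move=> mD; apply/eqP/cmP => y.
rewrite (big_morph (fun m : {cmonom X} => m y : nat) (cmM y) (cm1 y)).
have coordE x : (\big[mmul/mone]_(i < m x) ucm x : {cmonom X}) y = (m x * (x == y))%N.
  rewrite (big_morph (fun m : {cmonom X} => m y : nat) (cmM y) (cm1 y)).
  by under eq_bigr do rewrite cmU; rewrite sum_nat_const card_ord.
under eq_bigr do rewrite coordE; have [yD|yD] := boolP (y \in D).
  rewrite (big_fsetD1 y) //= eqxx muln1 big1_seq ?addn0 // => x /andP[_].
  by rewrite !inE => /andP[/negPf-> _]; rewrite muln0.
rewrite big1_seq => [|x /andP[_ xD]]; last first.
  by rewrite (_ : x == y = false) ?muln0 //; apply: contraNF yD => /eqP<-.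
by apply/eqP; rewrite cmE_eq0; apply: contra yD; apply: (fsubsetP mD).
Qed.

Lemma malg_prod_var (m : {cmonom X}) (D : {fset X}) : (finsupp m `<=` D)%fset ->
  << m >> = \prod_(x <- D) qvar x ^+ m x :> Qpoly X.
Proof.
have malgUM (m1 m2 : {cmonom X}) : << mmul m1 m2 >> = << m1 >> * << m2 >> :> Qpoly X.
  by rewrite [RHS]fgmulUU mulr1.
have malgU_prod := big_morph (fun m : {cmonom X} => << m >> : Qpoly X) malgUM (erefl _).
move=> mD; rewrite {1}(cmonom_prod mD) malgU_prod; apply: eq_bigr => x _.
by rewrite malgU_prod prodr_const card_ord.
Qed.

Section Nodes.
Variables (D : {fset X}) (N : nat).
Implicit Type b : {ffun D -> 'I_N}.

Definition node b (x : X) : nat := if insub x is Some x' then b x' else 0.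

Lemma node_val b (x : D) : node b (val x) = b x.
Proof. by rewrite /node valK. Qed.

Definition lagrange_prod b : IntZ X := \prod_(x : D) IntZ_lagrange N (val x) (b x).

Lemma val_lagrange_prod b : IntZ_val (lagrange_prod b) =
  \prod_(x : D) IntZ_val (IntZ_lagrange N (val x) (b x)).
Proof. exact: (rmorph_prod (val : {rmorphism IntZ X -> Qpoly X})). Qed.

Definition in_box (m : {cmonom X}) : Prop :=
  (finsupp m `<=` D)%fset /\ forall x, (m x < N)%N.

Lemma malg_lagrange (m : {cmonom X}) : in_box m ->
  << m >> = \sum_b meval (fun x => (node b x)%:R) m *: IntZ_val (lagrange_prod b)
    :> Qpoly X.
Proof.
move=> [mD mN]; rewrite (malg_prod_var mD) big_seq_fsetE /=.
have powE (x : D) : qvar (val x) ^+ m (val x) = \sum_(b < N)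
    (b%:R ^+ m (val x)) *: IntZ_val (IntZ_lagrange N (val x) b) :> Qpoly X.
  rewrite -{1}[qvar _](horner_algX (R := rat)) -rmorphXn /=.
  rewrite (@lagrange_interpolation _ N 'X^_) ?size_polyXn // linear_sum.
  by apply: eq_bigr => b _; rewrite linearZ /= mulr_algl hornerXn IntZ_lagrange_horner.
under eq_bigr do rewrite powE.
rewrite bigA_distr_bigA; apply: eq_bigr => b _; rewrite val_lagrange_prod.
rewrite /meval (big_fset_incl _ mD) => [|x _]; last first.
  by rewrite -cmE_neq0 negbK => /eqP->.
rewrite big_seq_fsetE -scaler_prod.
by apply: eq_bigr => x _; rewrite node_val.
Qed.

Lemma IntZ_lagrange_interpolation (q : IntZ X) :
    {in msupp (IntZ_val q), forall m, in_box m} ->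
  q = \sum_b IntZ_eval q (fun x => (node b x)%:Z) *: lagrange_prod b.
Proof.
move=> q_box; apply: val_inj; rewrite rmorph_sum /=.
under [RHS]eq_bigr do rewrite IntZ_valZ IntZ_evalE /qeval mmapE scaler_suml.
rewrite exchange_big /= [LHS]monalgE; apply: eq_big_seq => m /q_box m_box.
rewrite malgUZ (malg_lagrange m_box) scaler_sumr; apply: eq_bigr => b _.
by rewrite scalerA.
Qed.

End Nodes.

Lemma IntZ_interpolation (l : seq (IntZ X)) : exists (D : {fset X}) (N : nat),
  {in l, forall q, q = \sum_(b : {ffun D -> 'I_N})
    IntZ_eval q (fun x => (node b x)%:Z) *: lagrange_prod b}.
Proof.
exists (\bigcup_(q <- l) \bigcup_(m <- msupp (IntZ_val q)) finsupp m)%fset.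
exists (\max_(q <- l) msize (IntZ_val q)) => q ql.
apply: IntZ_lagrange_interpolation => m mq; split=> [|x].
  apply: fsubset_trans (@bigfcup_sup _ _ _ _ xpredT
    (fun q => \bigcup_(m <- msupp (IntZ_val q)) finsupp m)%fset ql isT).
  exact: (@bigfcup_sup _ _ _ _ xpredT (fun m : {cmonom X} => finsupp m)).
apply: leq_trans (@leq_bigmax_seq _ _ xpredT (fun q => msize (IntZ_val q)) _ ql isT).
apply: leq_ltn_trans (msize_mdeg_lt mq).
have [xm|] := boolP (x \in finsupp m); last by rewrite -cmE_eq0 => /eqP->.
by rewrite mdegE (big_fsetD1 x) //= leq_addr.
Qed.

End IntegerValuedInterpolation.

(** * Evaluation of integer-valued polynomials *)

Section EvaluationZ.
Variable X : choiceType.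
Implicit Types (q r : IntZ X) (a : X -> int).

Definition evalZ a q : int := IntZ_eval q a.

Lemma evalZ_is_zmod_morphism a : zmod_morphism (evalZ a).
Proof.
by move=> q r; apply: (@intr_inj rat); rewrite rmorphB /= !IntZ_evalE rmorphB.
Qed.

Lemma evalZ_is_monoid_morphism a : monoid_morphism (evalZ a).
Proof.
split=> [|q r]; apply: (@intr_inj rat); first by rewrite IntZ_evalE rmorph1.
by rewrite rmorphM /= !IntZ_evalE rmorphM.
Qed.

HB.instance Definition _ a :=
  GRing.isZmodMorphism.Build (IntZ X) int (evalZ a) (evalZ_is_zmod_morphism a).
HB.instance Definition _ a :=
  GRing.isMonoidMorphism.Build (IntZ X) int (evalZ a) (evalZ_is_monoid_morphism a).

Lemma evalZ_var a x : evalZ a (IntZ_var x) = a x.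
Proof. by apply: (@intr_inj rat); rewrite IntZ_evalE qeval_var. Qed.

Lemma qeval0_mcoeff (q : Qpoly X) : qeval (fun=> 0) q = mcoeff mone q.
Proof.
rewrite {2}[q]monalgE raddf_sum /qeval mmapE; apply: eq_bigr => m _ /=.
rewrite mcoeffU; case: eqVneq => [->|m1].
  by rewrite /meval mdom1 big_seq_fset0 mulr1.
have [x xm] : exists x, x \in finsupp m.
  apply/fset0Pn; apply: contra_neq m1 => m0; apply/eqP/cmP => y.
  by apply/eqP; rewrite cm1 cmE_eq0 m0.
by rewrite /meval (big_fsetD1 x) //= expr0n cmE_eq0 xm /= mul0r mulr0.
Qed.

Lemma IntZ_zero_constE q : (q \in @IntZ_zero_const X) = (evalZ (fun=> 0) q == 0).
Proof. by rewrite -(eqr_int rat) IntZ_evalE qeval0_mcoeff. Qed.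

End EvaluationZ.

Section EvaluationF.
Variables (X : choiceType) (p : nat) (p_pr : prime p).
Local Notation F := (IntF X p_pr).
Local Notation pi := (\pi_F : {rmorphism IntZ X -> F}).
Implicit Types (q r : IntZ X) (a : X -> 'F_p) (u v : F).

Definition lift_Fp a : X -> int := fun x => (a x : nat)%:Z.

Lemma evalZ_ideal a q :
  q \in @IntF_ideal X p p_pr -> (evalZ (lift_Fp a) q)%:~R = 0 :> 'F_p.
Proof.
move: q; apply: (@lspan_ind _ (IntZ X)^o (@IntF_gen X p)) => [|r g q].
  by rewrite !rmorph0.
rewrite -[r *: g]/(r * g : IntZ X) !(rmorphD, rmorphM) /= => gen_g _ ->.
suff -> : (evalZ (lift_Fp a) g)%:~R = 0 :> 'F_p by rewrite mulr0 addr0.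
case: gen_g => [[x [n [le_pn gE]]]|->]; last by rewrite !rmorph_nat pchar_Fp_0.
have lt_an : (a x < n)%N.
  by apply: leq_trans le_pn; rewrite -{2}(Fp_cast p_pr) ltn_ord.
suff -> : evalZ (lift_Fp a) g = 0 by [].
apply: (@intr_inj rat); rewrite IntZ_evalE gE /qbinom -mul_malgC rmorphM.
rewrite [X in X * _]mmapC rmorph_prod /= (bigD1 (Ordinal lt_an)) //=.
by rewrite rmorphB rmorph_nat /= qeval_var -[_%:~R]/(_%:R) subrr mul0r mulr0.
Qed.

Definition evalF a u : 'F_p := IntF_eval u a.

Lemma pi_repr u : pi (repr u) = u.
Proof. exact: reprK. Qed.

Lemma evalF_pi a q : evalF a (pi q) = (evalZ (lift_Fp a) q)%:~R.
Proof.
rewrite -[LHS]/((evalZ (lift_Fp a) (repr (pi q)))%:~R).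
apply/eqP; rewrite -subr_eq0 -rmorphB /= -rmorphB; apply/eqP/evalZ_ideal.
by rewrite Quotient.idealrBE; apply/eqP; rewrite reprK.
Qed.

Lemma evalF_is_zmod_morphism a : zmod_morphism (evalF a).
Proof.
by move=> u v; rewrite -(pi_repr u) -(pi_repr v) -rmorphB !evalF_pi !rmorphB.
Qed.

Lemma evalF_is_monoid_morphism a : monoid_morphism (evalF a).
Proof.
split=> [|u v]; first by rewrite -(rmorph1 pi) evalF_pi !rmorph1.
by rewrite -(pi_repr u) -(pi_repr v) -rmorphM !evalF_pi !rmorphM.
Qed.

HB.instance Definition _ a :=
  GRing.isZmodMorphism.Build F 'F_p (evalF a) (evalF_is_zmod_morphism a).
HB.instance Definition _ a :=
  GRing.isMonoidMorphism.Build F 'F_p (evalF a) (evalF_is_monoid_morphism a).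

Lemma evalF_var a x : evalF a (IntF_var p_pr x) = a x.
Proof.
by rewrite -[IntF_var _ _]/(pi (IntZ_var x)) evalF_pi evalZ_var -pmulrn natr_Zp.
Qed.

Lemma IntF_zero_constP u :
  u \in @IntF_zero_const X p p_pr <-> evalF (fun=> 0) u = 0.
Proof.
have lift0 : lift_Fp (fun=> 0) = fun=> 0 by apply: funext.
split=> [/asboolP[q q0 <-]|u0].
  rewrite -[\pi_F q]/(pi q) evalF_pi lift0; move: q0.
  by rewrite IntZ_zero_constE => /eqP->.
apply/asboolP; exists (repr u - (evalZ (fun=> 0) (repr u))%:~R).
  by rewrite IntZ_zero_constE rmorphB rmorph_int intz subrr.
have := evalF_pi (fun=> 0) (repr u); rewrite pi_repr u0 lift0 => pi_const.
rewrite -[LHS]/(pi _) rmorphB pi_repr rmorph_int.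
by rewrite -[_%:~R](rmorph_int (in_alg F)) -pi_const rmorph0 subr0.
Qed.

End EvaluationF.

Section Evaluation.
Variables (k : coef) (X : choiceType).
Local Notation R := (coef_ring k).
Local Notation B := (IntR k X).
Implicit Types (q r : B) (a : X -> R) (c : R).

Definition evalR a q : R := IntR_eval q a.

Lemma evalR_is_monoid_morphism a : monoid_morphism (evalR a).
Proof.
rewrite /evalR; case: k a => [|p p_pr] a; split=> [|q r].
- exact: (rmorph1 (evalZ a)).
- exact: (rmorphM (evalZ a)).
- exact: (rmorph1 (evalF a)).
- exact: (rmorphM (evalF a)).
Qed.

Lemma evalR_is_scalar a : scalar (evalR a).
Proof.
rewrite /evalR; case: k a => [|p p_pr] a c q r.
  by rewrite -[LHS]/(evalZ a (q *~ c + r)) rmorphD rmorphMz /= mulrzz mulrC.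
rewrite -[LHS]/(evalF a (q *+ (c : nat) + r)) rmorphD rmorphMn.
by rewrite -mulr_natl natr_Zp.
Qed.

HB.instance Definition _ a :=
  GRing.isLinear.Build R B R *%R (evalR a) (evalR_is_scalar a).
HB.instance Definition _ a :=
  GRing.isMonoidMorphism.Build B R (evalR a) (evalR_is_monoid_morphism a).

Lemma evalR_var a x : evalR a (IntR_var k x) = a x.
Proof.
by rewrite /evalR; case: k a => [|p p_pr] a; [exact: evalZ_var|exact: evalF_var].
Qed.

Lemma zero_constP q : q \in @zero_const k X <-> evalR (fun=> 0) q = 0.
Proof.
rewrite /evalR; case: k q => [|p p_pr] q; last exact: IntF_zero_constP.
by rewrite [q \in _]IntZ_zero_constE; split=> /eqP.
Qed.

Lemma rmorph_IntZ_scale (f : {rmorphism IntZ X -> B}) (n : int) (q : IntZ X) :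
  f (n *: q) = n%:~R *: f q.
Proof. by rewrite !scaler_int rmorphMz. Qed.

Definition pure_subalgebra (P : B -> Prop) : Prop :=
  [/\ P 1, forall c q r, P q -> P r -> P (c *: q + r),
      forall q r, P q -> P r -> P (q * r), forall x, P (IntR_var k x)
    & forall c q, GRing.lreg c -> P (c *: q) -> P q].

Section PureSubalgebra.
Variable P : B -> Prop.
Hypothesis P_pure : pure_subalgebra P.

Lemma pure_subalgebra0 : P 0.
Proof.
have [P1 PL _ _ _] := P_pure.
by have := PL (-1) _ _ P1 P1; rewrite scaleN1r addNr.
Qed.

Lemma pure_subalgebraZ c q : P q -> P (c *: q).
Proof.
have [_ PL _ _ _] := P_pure => Pq.
by rewrite -[c *: q]addr0; apply: PL => //; apply: pure_subalgebra0.
Qed.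

Lemma pure_subalgebra_sum (I : Type) (s : seq I) (Q : pred I) (f : I -> B) :
  (forall i, P (f i)) -> P (\sum_(i <- s | Q i) f i).
Proof.
have [_ PL _ _ _] := P_pure => Pf.
apply: (big_ind P) => // [|q r Pq Pr]; first exact: pure_subalgebra0.
by rewrite -[q]scale1r; apply: PL.
Qed.

Lemma pure_subalgebra_prod (I : Type) (s : seq I) (Q : pred I) (f : I -> B) :
  (forall i, P (f i)) -> P (\prod_(i <- s | Q i) f i).
Proof. by have [P1 _ PM _ _] := P_pure => Pf; apply: (big_ind P). Qed.

Section Image.
Variable f : {rmorphism IntZ X -> B}.
Hypothesis f_var : forall x, f (IntZ_var x) = IntR_var k x.

Lemma pure_subalgebra_binom x n :
  GRing.lreg (n`!%:R : R) -> P (f (IntZ_binom x n)).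
Proof.
have [P1 PL _ Pv Pp] := P_pure => n_reg; apply: (Pp _ _ n_reg).
rewrite scaler_nat -rmorphMn -scaler_nat IntZ_binom_fact rmorph_prod.
apply: pure_subalgebra_prod => i; rewrite rmorphB rmorph_nat f_var addrC.
by rewrite -scaler_nat -scaleN1r scalerA; apply: PL.
Qed.

Lemma pure_subalgebra_lagrange_prod (D : {fset X}) N (b : {ffun D -> 'I_N}) :
  (forall x n, P (f (IntZ_binom x n))) -> P (f (lagrange_prod b)).
Proof.
move=> P_binom; rewrite rmorph_prod; apply: pure_subalgebra_prod => x.
rewrite rmorph_sum; apply: pure_subalgebra_sum => n.
by rewrite rmorph_IntZ_scale; apply: pure_subalgebraZ.
Qed.

End Image.
End PureSubalgebra.

Definition purely_generated q : Prop := forall P, pure_subalgebra P -> P q.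

End Evaluation.

Section InterpolationF.
Variables (X : choiceType) (p : nat) (p_pr : prime p).
Local Notation F := (IntF X p_pr).
Local Notation pi := (\pi_F : {rmorphism IntZ X -> F}).

Lemma pi_scale (n : int) (q : IntZ X) : pi (n *: q) = n%:~R *: pi q.
Proof. exact: (@rmorph_IntZ_scale (CoefF p_pr) X pi). Qed.

Lemma pi_binom x n : (p <= n)%N -> pi (IntZ_binom x n) = 0.
Proof.
move=> le_pn; rewrite -(rmorph0 pi); apply/eqP; rewrite -Quotient.idealrBE subr0.
by apply: (@mem_lspan _ (IntZ X)^o); left; exists x, n.
Qed.

Lemma pi_lagrange N x b : (p <= b)%N -> pi (IntZ_lagrange N x b) = 0.
Proof.
move=> le_pb; rewrite rmorph_sum big1 // => n _; rewrite pi_scale.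
have [/newton_coef_gt->|le_bn] := ltnP n b; first by rewrite scale0r.
by rewrite pi_binom ?scaler0 // (leq_trans le_pb).
Qed.

Lemma IntF_interpolation (l : seq F) : exists (D : {fset X}) (N : nat),
  {in l, forall u, u = \sum_(b : {ffun D -> 'I_N})
    evalF (fun x => (node b x)%:R) u *: pi (lagrange_prod b)}.
Proof.
have [D [N DN]] := IntZ_interpolation [seq repr u | u : F <- l].
exists D, N => u ul.
have /DN repr_uE : repr u \in [seq repr u | u : F <- l] by apply: map_f.
rewrite -[in LHS](pi_repr u) {1}repr_uE rmorph_sum; apply: eq_bigr => b _.
rewrite pi_scale -{2}(pi_repr u) evalF_pi.
have [/existsP[x le_pb]|] := boolP [exists x : D, p <= b x]%N.
  suff -> : pi (lagrange_prod b) = 0 by rewrite !scaler0.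
  by rewrite rmorph_prod (bigD1 x) //= pi_lagrange ?mul0r.
rewrite negb_exists => /forallP lt_bp; congr ((IntZ_eval _ _)%:~R *: _).
apply: funext => x; rewrite /lift_Fp /node; case: insubP => [x' _ _|_].
  by rewrite val_Fp_nat // modn_small // ltnNge lt_bp.
by rewrite val_Fp_nat // mod0n.
Qed.

End InterpolationF.

Section InterpolationR.
Variables (k : coef) (X : choiceType).
Local Notation R := (coef_ring k).
Local Notation B := (IntR k X).
Local Notation ev := (fun a : X -> R => evalR a : {scalar B}).

Lemma IntR_interpolation (l : seq B) :
  exists (I : finType) (a : I -> X -> R) (e : I -> B),
    (forall i, purely_generated (e i)) /\ {in l, forall q, interpolates ev a e q}.
Proof.
rewrite /interpolates /evalR; case: k l => [|p p_pr] l.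
  have [D [N DN]] := IntZ_interpolation l.
  exists {ffun D -> 'I_N}, (fun b x => (node b x)%:Z), (@lagrange_prod X D N).
  split=> // b P P_pure; pose id_rmorph : {rmorphism IntZ X -> IntZ X} := idfun.
  apply: (pure_subalgebra_lagrange_prod P_pure (f := id_rmorph)) => x n.
  apply: (pure_subalgebra_binom P_pure (f := id_rmorph)) => //.
  by apply/lregP; rewrite pnatr_eq0 -lt0n fact_gt0.
have [D [N DN]] := IntF_interpolation l.
exists {ffun D -> 'I_N}, (fun b x => (node b x)%:R).
exists (fun b => \pi_(IntF X p_pr) (lagrange_prod b)); split=> // b P P_pure.
pose pi : {rmorphism IntZ X -> IntF X p_pr} := \pi_(IntF X p_pr).
apply: (pure_subalgebra_lagrange_prod P_pure (f := pi)) => x n.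
have [le_pn|lt_np] := leqP p n.
  by rewrite pi_binom //; apply: pure_subalgebra0 P_pure.
apply: (pure_subalgebra_binom P_pure) => //; apply/coef_lreg.
exact: Fp_fact_neq0.
Qed.

Lemma IntR_interpolable : interpolable ev.
Proof.
by move=> l; have [I [a [e [_ eE]]]] := IntR_interpolation l; exists I, a, e.
Qed.

Lemma IntR_purely_generated (q : B) : purely_generated q.
Proof.
move=> P P_pure; have [I [a [e [Pe eE]]]] := IntR_interpolation [:: q].
have -> : interpolates ev a e q by apply: eE; rewrite inE.
apply: (pure_subalgebra_sum P_pure) => i.
by apply: (pure_subalgebraZ P_pure); apply: Pe.
Qed.

Lemma evalR_inj (q r : B) : (forall a, evalR a q = evalR a r) -> q = r.
Proof. exact: (interpolable_inj IntR_interpolable). Qed.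

Lemma evalR_hom a : algebra_hom (W := R^o) (1 : B) *%R 1 *%R (evalR a).
Proof. by split; [apply: rmorph1|apply: rmorphM]. Qed.

Lemma IntR_binomial_algebra : @binomial_algebra k B 1 *%R.
Proof.
pose evl a : {linear B -> R^o} := evalR a.
have R_bin := coef_binomial_algebra k.
apply: (binomial_algebra_pullback (f := evl) evalR_hom evalR_inj R_bin) => q n n_k.
have [w wE] := choice (fun a => binomial_algebra_falling (evl a q) R_bin n_k).
have [a|z zE] := interpolable_divide (v := falling (1 : B) *%R q n) (g := w)
  IntR_interpolable (coef_fact_lreg n_k).
  by rewrite [LHS](algebra_hom_falling (f := evl a) _ _ (evalR_hom a)) -wE mulr_natl.
exists z; apply: evalR_inj => a; rewrite linearMn [X in X *+ _]zE wE.
by rewrite [RHS](algebra_hom_falling (f := evl a) _ _ (evalR_hom a)).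
Qed.

End InterpolationR.

(** * Tensor powers *)

Section TensorPowers.
Variables (R : comNzRingType) (U : lmodType R).
Local Notation T := (tpow U).

Lemma tnth_tset n (t : n.-tuple U) i u j :
  tnth (tset t i u) j = if j == i then u else tnth t j.
Proof. by rewrite tnth_mktuple. Qed.

Lemma tens_multilinear n : multilinear (@tens R U n).
Proof.
move=> t i r u u'.
pose pi : {additive {malg R[n.-tuple U]} -> lquot (@tens_rel R U n)} :=
  \pi_(lquot (@tens_rel R U n)).
rewrite -[LHS]/(pi _) -[RHS]/(lquot_scale r (pi _) + pi _) lquot_scale_pi -raddfD.
apply/eqP; rewrite -Quotient.idealrBE; apply: mem_lspan.
by exists t, i, r, u, u'; rewrite opprD addrA.
Qed.

Section Lift.
Variable n : nat.

Lemma eq_tlift (W : lmodType R) (f g : n.-tuple U -> W) : f =1 g -> tlift f =1 tlift g.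
Proof. by move=> fg u; apply: eq_bigr => t _; rewrite fg. Qed.

Lemma eq_scalar_tlift (f g : n.-tuple U -> R^o) : f =1 g -> tlift f =1 tlift g.
Proof. exact: eq_tlift. Qed.

Lemma tlift_comb (W : lmodType R) c (f g : n.-tuple U -> W) u :
  tlift (fun t => c *: f t + g t) u = c *: tlift f u + tlift g u.
Proof.
rewrite scaler_sumr -big_split; apply: eq_bigr => t _.
by rewrite scalerDr !scalerA mulrC.
Qed.

Lemma tlift_scale (W : lmodType R) c (f : n.-tuple U -> W) u :
  tlift (fun t => c *: f t) u = c *: tlift f u.
Proof.
by rewrite scaler_sumr; apply: eq_bigr => t _; rewrite !scalerA mulrC.
Qed.

Lemma scalar_tlift (W : lmodType R) (h : {scalar W}) (f : n.-tuple U -> W) u :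
  h (tlift f u) = tlift (fun t => h (f t) : R^o) u.
Proof. by rewrite linear_sum; apply: eq_bigr => t _; rewrite scalarZ. Qed.

Lemma tlift_tens (u : T n) : tlift (@tens R U n) u = u.
Proof.
rewrite -[RHS]lquotK [repr u]monalgE raddf_sum; apply: eq_bigr => t _ /=.
by rewrite malgUZ; apply: lquot_scale_pi.
Qed.

End Lift.

Section Cons.
Variable n : nat.

Lemma tset_cons0 (q u : U) (t : n.-tuple U) :
  tset [tuple of q :: t] ord0 u = [tuple of u :: t].
Proof.
apply: eq_from_tnth => i; rewrite tnth_tset.
by case: (unliftP ord0 i) => [j ->|->]; rewrite ?eqxx ?tnth0 // !tnthS.
Qed.

Lemma tset_consS (q : U) (t : n.-tuple U) i u :
  [tuple of q :: tset t i u] = tset [tuple of q :: t] (lift ord0 i) u.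
Proof.
apply: eq_from_tnth => j; rewrite tnth_tset.
case: (unliftP ord0 j) => [j' ->|->]; last by rewrite !tnth0.
by rewrite !tnthS tnth_tset (inj_eq lift_inj).
Qed.

Definition tens_cons (q : U) : T n -> T n.+1 := tlift (fun t => tens [tuple of q :: t]).

Lemma tens_cons_spec q : linear (tens_cons q) /\
  forall t, tens_cons q (tens t) = tens [tuple of q :: t].
Proof.
by apply: tlift_spec => t i c u u'; rewrite !tset_consS; apply: tens_multilinear.
Qed.

Lemma tens_consE q t : tens_cons q (tens t) = tens [tuple of q :: t].
Proof. by have [_ ->] := tens_cons_spec q. Qed.

Lemma tens_cons_linear q : linear (tens_cons q).
Proof. by have [] := tens_cons_spec q. Qed.

HB.instance Definition _ q :=
  GRing.isLinear.Build R (T n) (T n.+1) _ (tens_cons q) (tens_cons_linear q).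

Lemma tens_consl_linear (v : T n) : linear (tens_cons^~ v).
Proof.
move=> c q r; rewrite -tlift_comb; apply: eq_tlift => t.
have := tens_multilinear [tuple of 0 :: t] ord0 c q r.
by rewrite !tset_cons0.
Qed.

End Cons.

Section TensorEvaluation.
Variables (S : Type) (ev : S -> {scalar U}).

Definition tens_eval n (s : simplex S n) (u : T n) : R :=
  tlift (fun t => \prod_(i < n) ev (s i) (tnth t i) : R^o) u.

Lemma tens_eval_spec n (s : simplex S n) : scalar (tens_eval s) /\
  forall t, tens_eval s (tens t) = \prod_(i < n) ev (s i) (tnth t i).
Proof.
apply: (@tlift_spec _ _ _ R^o) => t i c u u'.
have prodE q : \prod_(j < n) ev (s j) (tnth (tset t i q) j)
    = ev (s i) q * \prod_(j < n | j != i) ev (s j) (tnth t j).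
  rewrite (bigD1 i) //= tnth_tset eqxx; congr (_ * _).
  by apply: eq_bigr => j /negPf ji; rewrite tnth_tset ji.
by rewrite !prodE -[RHS]/(c * _ + _) scalarP mulrDl mulrA.
Qed.

Lemma tens_eval_is_scalar n (s : simplex S n) : scalar (tens_eval s).
Proof. by have [] := tens_eval_spec s. Qed.

HB.instance Definition _ n s :=
  GRing.isLinear.Build R (T n) R *%R (@tens_eval n s) (tens_eval_is_scalar s).

Lemma tens_eval_tens n (s : simplex S n) t :
  tens_eval s (tens t) = \prod_(i < n) ev (s i) (tnth t i).
Proof. by have [_ ->] := tens_eval_spec s. Qed.

Definition simplex_cons n (a : S) (s : simplex S n) : simplex S n.+1 := fun i =>
  oapp s a (unlift ord0 i).

Lemma tens_eval_cons n a (s : simplex S n) q (t : n.-tuple U) :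
  tens_eval (simplex_cons a s) (tens [tuple of q :: t]) = ev a q * tens_eval s (tens t).
Proof.
rewrite !tens_eval_tens big_ord_recl tnth0 /simplex_cons unlift_none; congr (_ * _).
by apply: eq_bigr => i _; rewrite liftK tnthS.
Qed.

Hypothesis ev_interp : interpolable ev.

Lemma tens_interpolation n (l : seq U) :
  exists (J : finType) (p : J -> simplex S n) (b : J -> T n),
    forall t : n.-tuple U, {subset t <= l} ->
      interpolates (fun s => tens_eval s : {scalar T n}) p b (tens t).
Proof.
have [I [a [e ae]]] := ev_interp l; elim: n => [|n [J [p [b pb]]]].
  have s0 : simplex S 0 by case.
  exists unit, (fun=> s0), (fun=> tens [tuple]) => t _.
  rewrite /interpolates big_const card_unit /= addr0 tens_eval_tens big_ord0 scale1r.
  by rewrite (tuple0 t).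
exists (I * J)%type, (fun ij => simplex_cons (a ij.1) (p ij.2)).
exists (fun ij => tens_cons (e ij.1) (b ij.2)) => t.
case/tupleP: t => q t tl.
have q_interp : interpolates ev a e q by apply: ae; apply: tl; rewrite inE eqxx.
have t_interp : interpolates (fun s => tens_eval s : {scalar T n}) p b (tens t).
  by apply: pb => u ut; apply: tl; rewrite inE ut orbT.
pose consl : {linear U -> T n.+1} := HB.pack (fun r => tens_cons r (tens t))
  (GRing.isLinear.Build _ _ _ _ _ (tens_consl_linear (tens t))).
transitivity (\sum_i \sum_j
    (ev (a i) q * tens_eval (p j) (tens t)) *: tens_cons (e i) (b j)); last first.
  rewrite pair_bigA; apply: eq_bigr => -[i j] _.
  exact: (congr1 ( *:%R^~ _) (esym (tens_eval_cons _ _ _ _))).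
rewrite -tens_consE -[LHS]/(consl q) {1}q_interp linear_sum; apply: eq_bigr => i _.
have cons_interp : tens_cons (e i) (tens t) =
    \sum_j tens_eval (p j) (tens t) *: tens_cons (e i) (b j).
  by rewrite [in LHS]t_interp linear_sum; apply: eq_bigr => j _; rewrite linearZZ.
rewrite linearZZ /= cons_interp scaler_sumr; apply: eq_bigr => j _.
by rewrite scalerA.
Qed.

Lemma tens_eval_interpolable n :
  interpolable (fun s => tens_eval s : {scalar T n}).
Proof.
move=> l; pose supp (u : T n) := msupp (repr u : {malg R[n.-tuple U]}).
have [I [p [b pb]]] := tens_interpolation n
  (flatten [seq flatten [seq val t | t <- supp u] | u <- l]).
exists I, p, b => u ul; rewrite -[u]tlift_tens.
apply: interpolates_sum => t ut; apply: pb => q qt.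
by apply/flatten_mapP; exists u => //; apply/flatten_mapP; exists t.
Qed.

End TensorEvaluation.
End TensorPowers.

(** * Realization of tensors as cochains *)

Section AugmentationIdeal.
Variables (k : coef) (X : choiceType).
Local Notation R := (coef_ring k).
Local Notation B := (IntR k X).
Local Notation m := (maug k X).
Implicit Types (q r : m) (a : X -> R) (c : R).

Definition maug_eval a q : R := evalR a (val q).

Lemma maug_eval_is_scalar a : scalar (maug_eval a).
Proof. by move=> c q r; rewrite /maug_eval linearPZ scalarP. Qed.

HB.instance Definition _ a :=
  GRing.isLinear.Build R m R *%R (maug_eval a) (maug_eval_is_scalar a).

Lemma maug_evalM a q r : maug_eval a (maug_mul q r) = maug_eval a q * maug_eval a r.
Proof. exact: rmorphM. Qed.

Lemma maug_eval_var a x : maug_eval a (maug_var k x) = a x.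
Proof. exact: evalR_var. Qed.

Lemma maug_eval0 q : maug_eval (fun=> 0) q = 0.
Proof. exact/zero_constP/valP. Qed.

Lemma sub_const_zero_const (b : B) : b - evalR (fun=> 0) b *: 1 \in @zero_const k X.
Proof. by apply/zero_constP; rewrite linearB scalarZ rmorph1 mulr1 subrr. Qed.

Definition augment (b : B) : m := MkMaug (sub_const_zero_const b).

Lemma augment_linear : linear augment.
Proof.
move=> c b b'; apply: val_inj; rewrite linearPZ /= scalarP scalerDl -scalerA.
by rewrite opprD addrACA scalerBr.
Qed.

HB.instance Definition _ := GRing.isLinear.Build R B m _ augment augment_linear.

Lemma augmentK q : augment (val q) = q.
Proof. by apply: val_inj; rewrite /= [evalR _ _]maug_eval0 scale0r subr0. Qed.

Lemma augment1 : augment 1 = 0.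
Proof. by apply: val_inj; rewrite /= rmorph1 scale1r subrr. Qed.

Lemma augment_var x : augment (IntR_var k x) = maug_var k x.
Proof. by apply: val_inj; rewrite /= evalR_var scale0r subr0. Qed.

Lemma augmentM (b b' : B) : augment (b * b') =
  evalR (fun=> 0) b *: augment b' + (evalR (fun=> 0) b' *: augment b
    + maug_mul (augment b) (augment b')).
Proof.
apply: val_inj; rewrite /= rmorphM /=; move: (evalR _ b) (evalR _ b') => c c'.
rewrite -scalerA -(mulr_algl c (c' *: 1)) -(mulr_algl c (b' - _)).
by rewrite -(mulr_algl c' (b - _)); move: (c%:A) (c'%:A) => x x'; ring.
Qed.

Lemma maug_interpolable : interpolable (fun a => maug_eval a : {scalar m}).
Proof.
move=> l; have [I [a [e ae]]] := @IntR_interpolable k X [seq val q | q <- l].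
exists I, a, (augment \o e) => q ql; have /ae val_qE := map_f val ql.
rewrite /interpolates -[LHS]augmentK {1}val_qE linear_sum.
by apply: eq_bigr => i _; rewrite linearZZ.
Qed.

Lemma maug_ind (P : m -> Prop) : P 0 ->
    (forall c q r, P q -> P r -> P (c *: q + r)) ->
    (forall c q, GRing.lreg c -> P (c *: q) -> P q) ->
    (forall x, P (maug_var k x)) -> (forall q r, P q -> P r -> P (maug_mul q r)) ->
  forall q, P q.
Proof.
move=> P0 PL Pdiv Pvar PM q; rewrite -[q]augmentK.
apply: (@IntR_purely_generated k X (val q) (fun b => P (augment b))); split.
- by rewrite augment1.
- by move=> c b b' Pb Pb'; rewrite linearPZ; apply: PL.
- by move=> b b' Pb Pb'; rewrite augmentM; do 2!apply: (PL) => //; apply: PM.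
- by move=> x; rewrite augment_var.
- by move=> c b c_reg; rewrite linearZZ; apply: Pdiv.
Qed.

End AugmentationIdeal.

Section Realization.
Variables (k : coef) (X : choiceType).
Local Notation R := (coef_ring k).
Local Notation m := (maug k X).
Local Notation T := (tpow m).
Local Notation M := (X -> R).
Local Notation A := (tensor_alg k X).
Local Notation BA := (bar_alg k X).
Local Notation ev := (fun a : M => maug_eval a : {scalar m}).

Definition realization n (u : A n) : BA n := fun s => tens_eval ev s u.

Lemma realization_linear n : linear (@realization n).
Proof. by move=> c u v; apply: cochainP => s; apply: scalarP. Qed.

HB.instance Definition _ n :=
  GRing.isLinear.Build R (A n) (BA n) _ (@realization n) (@realization_linear n).

Lemma realization_interpolable n :
  interpolable (fun s => tens_eval ev s : {scalar T n}).
Proof. exact/tens_eval_interpolable/maug_interpolable. Qed.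

Lemma realization_inj n : injective (@realization n).
Proof.
move=> u v uv; apply: (interpolable_inj (@realization_interpolable n)) => s.
exact: (congr1 (fun f : BA n => f s) uv).
Qed.

Lemma realization_divide n c (u : A n) (f : BA n) : GRing.lreg c ->
  realization u = c *: f -> exists w : A n, realization w = f.
Proof.
move=> c_reg uE.
have [s|w wE] :=
    interpolable_divide (v := u) (g := f) (@realization_interpolable n) c_reg.
  exact: (congr1 (fun g : BA n => g s) uE).
by exists w; apply: cochainP => s; apply: wE.
Qed.

Lemma realization_iota1 (q : m) s : realization (iota1 q) s = maug_eval (s ord0) q.
Proof. by rewrite /realization tens_eval_tens big_ord1. Qed.

Lemma realization1E (u : A 1%N) s : realization u s = maug_eval (s ord0) (deg1 u).
Proof.
rewrite /deg1 [RHS]scalar_tlift; apply: eq_scalar_tlift => t.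
by rewrite big_ord1.
Qed.

Lemma iota1K (q : m) : deg1 (iota1 q) = q.
Proof.
apply: (interpolable_inj (@maug_interpolable k X)) => a.
by have := realization1E (iota1 q) (fun=> a); rewrite realization_iota1.
Qed.

Lemma deg1K (u : A 1%N) : iota1 (deg1 u) = u.
Proof.
apply: realization_inj; apply: cochainP => s.
by rewrite realization_iota1 realization1E.
Qed.

Lemma realization2E (w : A 2%N) (s : simplex M 2) : realization w s =
  tlift2 (fun q r => maug_eval (s ord0) q * maug_eval (s ord_max) r : R^o) w.
Proof.
rewrite /realization /tens_eval /tlift2; apply: eq_scalar_tlift => t.
rewrite big_ord_recl big_ord1.
by congr (_ * maug_eval (s _) (tnth t _)); apply: val_inj.
Qed.

Lemma realization_tens2 (q r : m) s :
  realization (tens2 q r) s = maug_eval (s ord0) q * maug_eval (s ord_max) r.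
Proof.
rewrite /realization tens_eval_tens big_ord_recl big_ord1.
by congr (_ * maug_eval (s _) _); apply: val_inj.
Qed.

Lemma realization_tlift n i (F : i.-tuple m -> T n) u s :
  realization (tlift F u : A n) s = tlift (fun t => realization (F t : A n) s : R^o) u.
Proof. exact: (scalar_tlift (tens_eval ev s : {scalar T n})). Qed.

Lemma realization_one : realization (gr1 A) = gr1 BA.
Proof. by apply: cochainP => s; rewrite /realization tens_eval_tens big_ord0. Qed.

Lemma realization_cup i j (u : A i) (v : A j) :
  realization (cup u v) = cup (realization u) (realization v).
Proof.
apply: cochainP => s; rewrite bar_cupE.
set sl := fun l => s (lshift j l); set sr := fun l => s (rshift i l).
pose factors n (s : simplex M n) t : R^o := \prod_(l < n) maug_eval (s l) (tnth t l).
transitivity (tlift (fun t => realization v sr *: factors i sl t) u); last first.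
  by rewrite tlift_scale mulrC.
rewrite realization_tlift; apply: eq_scalar_tlift => t.
rewrite realization_tlift [RHS]mulrC -[RHS]tlift_scale; apply: eq_scalar_tlift => t'.
rewrite /realization tens_eval_tens big_split_ord.
by congr (_ * _); apply: eq_bigr => l _; rewrite ?tnth_lshift ?tnth_rshift.
Qed.

Lemma realization_cup1 : {morph @realization 1 : u v / cup1 u v}.
Proof.
move=> u v; apply: cochainP => s.
by rewrite bar_cup1E realization_iota1 maug_evalM !realization1E.
Qed.

Lemma realization_cup21 (w : A 2%N) (u : A 1%N) :
  realization (cup21 w u) = cup21 (realization w) (realization u).
Proof.
apply: cochainP => s; rewrite bar_cup21E !realization1E mulrC.
rewrite realization_tlift [X in _ * X]realization2E -[RHS]tlift_scale.
apply: eq_scalar_tlift => t; rewrite linearD cochainD.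
rewrite [X in X + _]realization_tens2 [X in _ + X]realization_tens2 !maug_evalM.
by rewrite -[RHS]/(_ * _ : R); ring.
Qed.

Lemma realization_circ : {morph @realization 2 : v w / circ v w}.
Proof.
move=> v w; apply: cochainP => s; rewrite bar_circE mulrC.
rewrite realization_tlift [X in _ * X]realization2E -[RHS]tlift_scale.
apply: eq_scalar_tlift => t.
rewrite realization_tlift [RHS]mulrC [X in _ * X]realization2E -[RHS]tlift_scale.
apply: eq_scalar_tlift => t'.
by rewrite realization_tens2 !maug_evalM mulrACA.
Qed.

Lemma realization_hom :
  cupone_hom (A := A) (B := BA) (fun n => @realization n : {linear A n -> BA n}).
Proof.
split; [exact: realization_one|exact: realization_cup|exact: realization_cup1
  |exact: realization_cup21|exact: realization_circ].
Qed.

End Realization.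

Section TensorAlgebra.
Variables (k : coef) (X : choiceType).
Local Notation R := (coef_ring k).
Local Notation B := (IntR k X).
Local Notation m := (maug k X).
Local Notation M := (X -> R).
Local Notation A := (tensor_alg k X).
Local Notation BA := (bar_alg k X).
Local Notation psi := (fun n => @realization k X n : {linear A n -> BA n}).

Lemma iota1_linear : linear (@iota1 k X).
Proof.
move=> c q r; have := tens_consl_linear (tens [tuple]) c q r.
by rewrite !tens_consE.
Qed.

Lemma iota1M (q r : m) : iota1 (maug_mul q r) = cup1 (iota1 q : A 1%N) (iota1 r).
Proof.
exact: (esym (f_equal2 (fun a b => iota1 (maug_mul a b)) (iota1K q) (iota1K r))).
Qed.

Lemma tens_cons_cup n (q : m) (t : n.-tuple m) :
  tens [tuple of q :: t] = cup (iota1 q : A 1%N) (tens t : A n).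
Proof.
apply: realization_inj; apply: cochainP => s.
rewrite (realization_cup (iota1 q) (tens t)) bar_cupE realization_iota1.
rewrite /realization !tens_eval_tens big_ord_recl tnth0; congr (maug_eval (s _) _ * _).
  exact: val_inj.
by apply: eq_bigr => i _; rewrite tnthS; congr (maug_eval (s _) _); apply: val_inj.
Qed.

(* Division by regular scalars is what produces the zeta_n(x). *)
Lemma tensor_alg_ind (P : forall n, A n -> Prop) :
    (forall n, @P n 0) ->
    (forall n c (u v : A n), P _ u -> P _ v -> P _ (c *: u + v)) ->
    (forall n c (u : A n), GRing.lreg c -> P _ (c *: u) -> P _ u) ->
    P _ (gr1 A) -> (forall x, P 1%N (iota1 (maug_var k x))) ->
    (forall u v : A 1%N, P _ u -> P _ v -> P _ (cup1 u v)) ->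
    (forall i j (u : A i) (v : A j), P _ u -> P _ v -> P _ (cup u v)) ->
  forall n (u : A n), P _ u.
Proof.
move=> P0 PL Pdiv P1 Pvar Pcup1 Pcup n u.
have P_iota1 (q : m) : P 1%N (iota1 q).
  move: q; apply: (@maug_ind k X (fun q => P 1%N (iota1 q))).
  - by rewrite (linear_map0 iota1_linear); apply: P0.
  - by move=> c q r Pq Pr; rewrite iota1_linear; apply: PL.
  - by move=> c q c_reg; rewrite (scalable_linear iota1_linear); apply: Pdiv.
  - exact: Pvar.
  - by move=> q r Pq Pr; rewrite iota1M; apply: Pcup1.
have P_tens (t : n.-tuple m) : P n (tens t).
  elim: n t {u} => [|n IHn] t; first by rewrite (tuple0 t).
  by case/tupleP: t => q t; rewrite tens_cons_cup; apply: (Pcup 1%N n).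
by rewrite -[u]tlift_tens; apply: (big_rec (@P n)) => // t v _; apply: PL.
Qed.

Definition unitized_IntR (x : unitized A) : B := x.1 *: 1 + val (deg1 x.2).

Lemma evalR_unitized a x :
  evalR a (unitized_IntR x) = unitized_eval (Some (fun=> a)) (unitized_map psi x).
Proof.
rewrite linearD scalarZ rmorph1 mulr1; congr (_ + _).
by rewrite [RHS]realization1E.
Qed.

Lemma unitized_IntR_linear : linear unitized_IntR.
Proof.
move=> c x y; apply: evalR_inj => a.
by rewrite [RHS]scalarP /= !evalR_unitized linearPZ scalarP.
Qed.

HB.instance Definition _ :=
  GRing.isLinear.Build R (unitized A) B _ unitized_IntR unitized_IntR_linear.

Lemma unitized_IntR_hom :
  algebra_hom (uone A) (@umul R A) 1 *%R unitized_IntR.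
Proof.
have [psi1 psiM] := unitized_map_hom (@realization_hom k X).
split=> [|x y]; apply: evalR_inj => a; rewrite evalR_unitized.
  by rewrite psi1 rmorph1; have [] := @unitized_eval_hom R M (Some (fun=> a)).
rewrite psiM rmorphM /= !evalR_unitized.
by have [_] := @unitized_eval_hom R M (Some (fun=> a)); apply.
Qed.

Lemma unitized_IntR_inj : injective unitized_IntR.
Proof.
move=> [r u] [r' u'] xy.
have evalE a : r + maug_eval a (deg1 u) = r' + maug_eval a (deg1 u').
  have := congr1 (evalR a) xy.
  by rewrite !linearD !scalarZ rmorph1 !mulr1.
have rE : r = r' by have := evalE (fun=> 0); rewrite !maug_eval0 !addr0.
rewrite -(deg1K u) -(deg1K u') rE; congr (_, iota1 _).
apply: (interpolable_inj (@maug_interpolable k X)) => a.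
by have := evalE a; rewrite rE => /addrI.
Qed.

Lemma unitized_IntR_augment (b : B) :
  unitized_IntR (evalR (fun=> 0) b, iota1 (augment b)) = b.
Proof. by rewrite /unitized_IntR /= iota1K /= addrC subrK. Qed.

Lemma tensor_unitized_binomial : binomial_algebra (uone A) (@umul R A).
Proof.
apply: (binomial_algebra_product (f := fun _ : unit => unitized_IntR)
  (fun _ => unitized_IntR_hom) _ _ (@IntR_binomial_algebra k X)).
- by move=> x y xy; apply/unitized_IntR_inj/xy/tt.
- move=> g; exists (evalR (fun=> 0) (g tt), iota1 (augment (g tt))) => -[].
  exact: unitized_IntR_augment.
Qed.

Lemma tensor_deg0_binomial :
  binomial_algebra (gr1 A) (fun u v : A 0%N => cup u v : A 0%N).
Proof.
apply: (binomial_algebra_product (f := fun _ : unit => psi 0%N) _ _ _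
  (bar_deg0_binomial k M)).
- by move=> _; split; [exact: realization_one|exact: (@realization_cup k X 0 0)].
- by move=> u v uv; apply/realization_inj/uv/tt.
- move=> g; exists (g tt (fun=> fun=> 0) *: gr1 A) => -[].
  rewrite linearZZ /= realization_one; apply: cochainP => s.
  rewrite cochainZ [gr1 BA s]/(1 : R) mulr1; congr (g tt _).
  by apply: funext => -[].
Qed.

End TensorAlgebra.

(** * The differential *)

Section Differential.
Variables (k : coef) (X : choiceType) (tau : X -> tpow (maug k X) 2).
Local Notation R := (coef_ring k).
Local Notation M := (X -> R).
Local Notation A := (tensor_alg k X).
Local Notation BA := (bar_alg k X).
Local Notation psi := (fun n => @realization k X n : {linear A n -> BA n}).
Local Notation dB := (d_bar tau).

Lemma realization_tau x :
  realization (tau x : A 2%N) = dB (realization (iota1 (maug_var k x))).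
Proof.
apply: cochainP => s; rewrite [RHS]bar_d1E !realization_iota1 !maug_eval_var /mu.
by rewrite [LHS]realization2E; move: (tlift2 _ _) => r; ring.
Qed.

Lemma d_bar_realized n (u : A n) :
  exists w : A n.+1, realization w = dB (realization u).
Proof.
have psi0 i : realization (0 : A i) = 0 by exact: linear0.
have dB_lin i : linear (@bar_d R M (mu tau) i) by apply: bar_d_linear.
apply: (tensor_alg_ind
  (P := fun i v => exists w : A i.+1, realization w = dB (realization v))).
- by move=> i; exists 0; rewrite !psi0 [RHS](linear_map0 (dB_lin i)).
- move=> i c v v' [w wE] [w' w'E]; exists (c *: w + w').
  by rewrite [LHS]realization_linear realization_linear [RHS]dB_lin wE w'E.
- move=> i c v c_reg [w wE]; apply: realization_divide c_reg _; apply: etrans wE _.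
  rewrite (scalable_linear (@realization_linear k X i)).
  exact: (scalable_linear (dB_lin i)).
- exists 0; rewrite psi0 (@realization_one k X).
  exact/esym/bar_d0E.
- by move=> x; exists (tau x); apply: realization_tau.
- move=> v v' [w wE] [w' w'E].
  exists (- cup v v' - cup v' v + cup21 w v' + cup21 w' v - circ w w').
  rewrite [LHS](hom_cup1_d_rhs (@realization_hom k X)) realization_cup1 /= wE w'E.
  by rewrite [RHS]bar_cup1_d.
- move=> i j v v' [w wE] [w' w'E].
  exists (cup w v' + (-1) ^+ i *: gcast (addnS i j) (cup v w')).
  rewrite [LHS](hom_leibniz_rhs (@realization_hom k X)) realization_cup /= wE w'E.
  by rewrite [RHS]bar_leibniz.
Qed.

Lemma is_d_tau_exists : exists d, is_d_tau tau d.
Proof.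
have [d dE] := exists_pullback_d (f := psi) d_bar_realized.
have psi_hom := @realization_hom k X; have psi_inj := @realization_inj k X.
exists d; split.
- exact: (pullback_d_linear psi_inj dE (@bar_d_linear R M (mu tau))).
- by move=> x; apply: realization_inj; rewrite [LHS]dE realization_tau.
- exact: (pullback_leibniz psi_hom psi_inj dE (@bar_leibniz R M (mu tau))).
- move=> u v; exact: (pullback_cup1_d psi_hom psi_inj dE
    (@bar_cup1_d R M (mu tau) (realization u) (realization v))).
Qed.

Lemma is_d_tau_commutes (d : degree1_map A) : is_d_tau tau d ->
  forall n (u : A n), realization (d n u) = dB (realization u).
Proof.
move=> [d_lin d_var d_leib d_cup1].
have psi_hom := @realization_hom k X; have psi_inj := @realization_inj k X.
have dB_lin := @bar_d_linear R M (mu tau).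
have A_alg := pullback_graded_algebra psi_hom psi_inj (@bar_graded_algebra R M).
apply: (tensor_alg_ind (P := commutes_at psi d dB)).
- by move=> n; apply: (commutes_at0 psi d_lin dB_lin).
- by move=> n c u v; apply: (commutes_at_comb (f := psi) d_lin dB_lin).
- move=> n c u c_reg; apply: (commutes_at_divide (f := psi) d_lin dB_lin).
  exact: cochain_scale_inj.
- apply: commutes_at_gr1; first exact: psi_hom; first exact: leibniz_gr1.
  exact: bar_d0E.
- by move=> x; rewrite /commutes_at d_var; apply: realization_tau.
- move=> u v; apply: (commutes_at_cup1 psi_hom); first exact: d_cup1.
  exact: bar_cup1_d.
- move=> i j u v; apply: (commutes_at_cup psi_hom); first exact: d_leib.
  exact: bar_leibniz.
Qed.

Lemma d_tau_unique : unique (is_d_tau tau) (d_tau tau).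
Proof.
have d_tauP : is_d_tau tau (d_tau tau).
  rewrite /d_tau; case: pselect => [ex|[]]; last exact: is_d_tau_exists.
  exact: svalP (cid ex).
split=> // d dP; apply: functional_extensionality_dep => n; apply: funext => u.
by apply: realization_inj; rewrite !is_d_tau_commutes.
Qed.

Lemma realization_d_tau n (u : A n) : realization (d_tau tau u) = dB (realization u).
Proof. by have [d_tauP _] := d_tau_unique; apply: is_d_tau_commutes. Qed.

Lemma realization_is_morphism : is_morphism (d_tau tau) dB (@realization k X).
Proof.
split.
- by split; [exact: realization_linear|exact: realization_one].
- exact: realization_cup.
- exact: realization_d_tau.
- exact: realization_cup1.
- move=> n u; apply: (cupone_hom_zeta1 u (@realization_hom k X)).
    exact: tensor_unitized_binomial.
  exact: bar_unitized_binomial.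
Qed.

Lemma extends_eval_unique (f : forall n, A n -> BA n) :
  is_morphism (d_tau tau) dB f -> extends_eval f ->
  forall n (u : A n), f n u = realization u.
Proof.
move=> [[f_lin f1] f_cup _ f_cup1 _] f_ev.
apply: (tensor_alg_ind (P := fun n u => f n u = realization u)).
- move=> n; rewrite (linear_map0 (f_lin n)).
  exact/esym/linear_map0/realization_linear.
- by move=> n c u v uE vE; rewrite f_lin uE vE [RHS]realization_linear.
- move=> n c u c_reg; rewrite (scalable_linear (f_lin n)).
  rewrite (scalable_linear (@realization_linear k X n)).
  exact: cochain_scale_inj.
- by rewrite f1; apply/esym/realization_one.
- by move=> x; apply: cochainP => s; rewrite f_ev [RHS]realization_iota1.
- by move=> u v uE vE; rewrite f_cup1 uE vE [RHS]realization_cup1.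
- by move=> i j u v uE vE; rewrite f_cup uE vE [RHS]realization_cup.
Qed.

End Differential.

Theorem theorem1p2 (k : coef) (X : choiceType) (tau : X -> tpow (maug k X) 2) :
  admissible tau ->
  [/\ unique (is_d_tau tau) (d_tau tau),
      forall n (u : tensor_alg k X n), d_tau tau (d_tau tau u) = 0,
      is_binomial_cupone_dga (d_tau tau),
      is_binomial_cupone_dga (d_bar tau)
    & exists psi : forall n, tensor_alg k X n -> bar_alg k X n,
      [/\ is_morphism (d_tau tau) (d_bar tau) psi,
          extends_eval psi,
          forall n, injective (psi n)
        & forall psi' : forall n, tensor_alg k X n -> bar_alg k X n,
            is_morphism (d_tau tau) (d_bar tau) psi' ->
            extends_eval psi' -> forall n u, psi' n u = psi n u]].
Proof.
move=> tau_adm.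
have bar_dga : is_cupone_dga (d_bar tau) := bar_cupone_dga (coef_ring k) tau_adm.
have tensor_dga : is_cupone_dga (d_tau tau) := pullback_cupone_dga
  (@realization_hom k X) (@realization_inj k X) (realization_d_tau tau) bar_dga.
split.
- exact: d_tau_unique.
- by have [[_ _ d_tau_d_tau _] _ _ _] := tensor_dga.
- by split; [|exact: tensor_deg0_binomial|exact: tensor_unitized_binomial].
- by split; [|exact: bar_deg0_binomial|exact: bar_unitized_binomial].
exists (@realization k X); split.
- exact: realization_is_morphism.
- exact: realization_iota1.
- exact: realization_inj.
- exact: extends_eval_unique.
Qed.
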